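(* Let $\mathcal{G}$ be an ideal of graphs, let $D$ be the diamond graph, and let $\mathcal{D}$ be the class of graphs with no topological minor isomorphic to $D$. Then the following are equivalent. 1. $\nu_{\mathcal{D}}$ is bounded on $\mathcal{G}$. 2. $e_{\mathcal{D}}$ is bounded on $\mathcal{G}$. 3. $\eta_{\mathcal{D}}$ is bounded on $\mathcal{G}$. 4. $\operatorname{FAN}(D,S) \not\subseteq \mathcal{G}$ for every $S \subseteq V(D)$ with $|S| \leq 1$, and $\mathcal{K}_{2,*} \not\subseteq \mathcal{G}$.
   Context: All graphs are finite and simple. The diamond $D$ is the graph obtained from $K_4$ by removing one edge. $H$ is a topological minor of $G$ if $G$ has a subgraph isomorphic to a subdivision of $H$ (edges replaced by internally disjoint paths of length at least $1$). An ideal is a class of graphs closed under isomorphisms and taking topological minors. $\mathcal{K}_{2,*}$ is the ideal of all graphs isomorphic to a topological minor of the complete bipartite graph $K_{2,n}$ for some $n$. For a class $\mathcal{C}$ of graphs closed under isomorphisms and subgraphs and a graph $G$: - $e_{\mathcal{C}}(G)$ (edit distance) is the minimum of $|E(G')\triangle E(G)|$ over all $G'\in\mathcal{C}$ with $V(G')=V(G)$; equivalently, the minimum number of edges whose deletion from $G$ gives a graph in $\mathcal{C}$. - $\eta_{\mathcal{C}}(G)$ ($\mathcal{C}$-edge-brittleness) is the minimum $\ell$ such that there is a partition $(V_1,\dots,V_n)$ of $V(G)$ with the induced subgraph $G[V_i]\in\mathcal{C}$ for all $i$ and exactly $\ell$ edges of $G$ having ends in distinct $V_i$'s. - $\nu_{\mathcal{C}}(G)$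 ($\bar{\mathcal{C}}$-capacity) is the maximum $\ell$ such that there exist pairwise edge-disjoint subgraphs $H_1,\dots,H_\ell$ of $G$ with $H_i\notin\mathcal{C}$ for each $i$. A graph parameter $f$ is bounded on a class $\mathcal{G}$ if there is a constant $M$ with $|f(G)|\le M$ for all $G\in\mathcal{G}$. For a graph $G$, $S\subsetneq V(G)$ and a positive integer $k$, $\operatorname{Fan}(G,S,k)$ is the graph obtained from $k$ vertex-disjoint copies of $G$ by identifying all the copies of $v$ for each $v\in S$ and identifying all the copies of $e$ for each $e\in E(G[S])$. $\operatorname{FAN}(G,S)$ is the ideal of all graphs isomorphic to a topological minor of $\operatorname{Fan}(G,S,k)$ for some positive integer $k$. *)

(* Defs.v *)
From HB Require Import structures.
From mathcomp Require Import all_boot.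

Set Implicit Arguments.
Unset Strict Implicit.
Unset Printing Implicit Defensive.

Record graph (V : finType) := Graph {
  adj :> rel V;
  adj_sym : symmetric adj;
  adj_irr : irreflexive adj
}.

Definition edges (V : finType) (G : graph V) : {set {set V}} :=
  [set [set x; y] | x in V, y in V & G x y].

Definition graph_class := forall V : finType, graph V -> Prop.

Definition subclass (C C' : graph_class) : Prop :=
  forall (V : finType) (G : graph V), C V G -> C' V G.

Definition isomorphic (V W : finType) (G : graph V) (H : graph W) : Prop :=
  exists f : V -> W, bijective f /\ forall x y, H (f x) (f y) = G x y.

Definition vset (V : finType) (U : {set V}) : finType := {x : V | x \in U}.

Record subgraph (V : finType) (G : graph V) := Subgraph {
  sub_verts : {set V};
  sub_graph :> graph (vset sub_verts);
  sub_adj : forall x y, sub_graph x y -> G (val x) (val y)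
}.

(* The edges of a subgraph, seen as edges of the ambient graph. *)
Definition sub_edges (V : finType) (G : graph V) (H : subgraph G) :
    {set {set V}} :=
  [set [set val x | x in e] | e : {set vset (sub_verts H)} in edges H].

Section Induced.
Variables (V : finType) (G : graph V) (U : {set V}).
Let induced_adj : rel (vset U) := fun x y => G (val x) (val y).
Fact induced_sym : symmetric induced_adj.
Proof. by move=> x y; apply: adj_sym. Qed.
Fact induced_irr : irreflexive induced_adj.
Proof. by move=> x; apply: adj_irr. Qed.
Definition induced : graph (vset U) := Graph induced_sym induced_irr.
End Induced.

(* K is, up to isomorphism, a subdivision of H: phi gives the branch vertices
   and I u v lists, from phi u to phi v, the internal vertices of the path that
   replaces the edge uv.  As I is indexed by ordered pairs, each path comes with
   its reversal.  The paths have distinct ends, hence length at least 1; the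
   last two conditions say that K has no other vertices and edges. *)
Definition subdivision (W U : finType) (H : graph W) (K : graph U) : Prop :=
  exists (phi : W -> U) (I : W -> W -> seq U),
    let P u v := phi u :: rcons (I u v) (phi v) in
    [/\ injective phi,
        forall u v, H u v ->
          [/\ path K (phi u) (rcons (I u v) (phi v)),
              uniq (P u v) &
              I v u = rev (I u v)],
        forall u v w, H u v -> phi w \notin I u v,
        forall u v u' v', H u v -> H u' v' -> [set u; v] != [set u'; v'] ->
          forall x, ~~ ((x \in I u v) && (x \in I u' v')) &
        (forall x, (exists w, x = phi w) \/
                   (exists u v, H u v /\ x \in I u v)) /\
        (forall x y, K x y -> exists u v, H u v /\ infix [:: x; y] (P u v))].

Definition topological_minor (W V : finType) (H : graph W) (G : graph V) :
    Prop :=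
  exists K : subgraph G, subdivision H K.

Definition ideal (C : graph_class) : Prop :=
  (forall (V W : finType) (G : graph V) (H : graph W),
     isomorphic G H -> C V G -> C W H) /\
  (forall (V W : finType) (G : graph V) (H : graph W),
     topological_minor H G -> C V G -> C W H).

(* A parameter is given by its graph: f V G l means that its value at G is l.
   Being bounded requires that the value exists. *)
Definition parameter := forall V : finType, graph V -> nat -> Prop.

Definition bounded_on (f : parameter) (C : graph_class) : Prop :=
  exists M : nat, forall (V : finType) (G : graph V),
    C V G -> exists l, f V G l /\ l <= M.

Definition is_min (P : nat -> Prop) (l : nat) : Prop :=
  P l /\ forall k, P k -> l <= k.

Definition is_max (P : nat -> Prop) (l : nat) : Prop :=
  P l /\ forall k, P k -> k <= l.

Definition edit_distance (C : graph_class) : parameter := fun V G =>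
  is_min (fun l => exists G' : graph V, C V G' /\
    #|(edges G' :\: edges G) :|: (edges G :\: edges G')| = l).

Definition cross_edges (V : finType) (G : graph V) (P : {set {set V}}) :
    {set {set V}} :=
  [set [set x; y] | x in V, y in V & G x y && (pblock P x != pblock P y)].

Definition edge_brittleness (C : graph_class) : parameter := fun V G =>
  is_min (fun l => exists P : {set {set V}},
    [/\ partition P [set: V],
        forall U, U \in P -> C (vset U) (induced G U) &
        #|cross_edges G P| = l]).

Definition capacity (C : graph_class) : parameter := fun V G =>
  is_max (fun l => exists H : 'I_l -> subgraph G,
    (forall i, ~ C _ (sub_graph (H i))) /\
    (forall i j, i != j -> [disjoint sub_edges (H i) & sub_edges (H j)])).

(* K_4, on 'I_4, without the edge joining 0 and 3. *)
Definition diamond_adj (i j : 'I_4) : bool :=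
  (i != j) && ([set i; j] != [set ord0; ord_max]).
Fact diamond_sym : symmetric diamond_adj.
Proof. by move=> i j; rewrite /diamond_adj eq_sym setUC. Qed.
Fact diamond_irr : irreflexive diamond_adj.
Proof. by move=> i; rewrite /diamond_adj eqxx. Qed.
Definition diamond : graph 'I_4 := Graph diamond_sym diamond_irr.

Definition diamond_free : graph_class := fun V G =>
  ~ topological_minor diamond G.

Section CompleteBipartite.
Variables m n : nat.
Let bip_adj : rel ('I_m + 'I_n)%type := fun x y =>
  match x, y with
  | inl _, inr _ | inr _, inl _ => true
  | _, _ => false
  end.
Fact bip_sym : symmetric bip_adj.
Proof. by move=> [i|i] [j|j]. Qed.
Fact bip_irr : irreflexive bip_adj.
Proof. by move=> [i|i]. Qed.
Definition complete_bipartite : graph ('I_m + 'I_n)%type :=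
  Graph bip_sym bip_irr.
End CompleteBipartite.

Definition K2_star : graph_class := fun V G =>
  exists n : nat, topological_minor G (complete_bipartite 2 n).

(* inl v is the common copy of v \in S; inr (i, v) is the i-th copy of
   v \notin S. *)
Section Fan.
Variables (V : finType) (G : graph V) (S : {set V}) (k : nat).
Definition fan_vertex : finType := (vset S + 'I_k * vset (~: S))%type.
Let fan_adj : rel fan_vertex := fun x y =>
  match x, y with
  | inl u, inl v => G (val u) (val v)
  | inl u, inr (_, v) => G (val u) (val v)
  | inr (_, u), inl v => G (val u) (val v)
  | inr (i, u), inr (j, v) => (i == j) && G (val u) (val v)
  end.
Fact fan_sym : symmetric fan_adj.
Proof.
by move=> [u|[i u]] [v|[j v]] /=; rewrite 1?(eq_sym i j) adj_sym.
Qed.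
Fact fan_irr : irreflexive fan_adj.
Proof. by move=> [u|[i u]] /=; rewrite adj_irr ?andbF. Qed.
Definition fan : graph fan_vertex := Graph fan_sym fan_irr.
End Fan.

(* Meant for S a proper subset of the vertex set. *)
Definition FAN (V : finType) (G : graph V) (S : {set V}) : graph_class :=
  fun W H => exists k : nat, 0 < k /\ topological_minor H (fan G S k).

(* Main.v *)
(* A graph has no diamond as a topological minor iff it contains no theta, that
   is, no three internally disjoint paths with common distinct ends.  Deleting
   the cross edges of a partition into diamond-free parts leaves a diamond-free
   graph, so e <= eta; each of nu edge-disjoint non-diamond-free subgraphs must
   lose an edge, so nu <= e; and Fan(D,S,n), |S| <= 1, and K_{2,3n} contain n
   edge-disjoint thetas.

   For the converse, let G have no large fan of thetas (disjoint, or pairwise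
   meeting in one vertex v) and no large K_{2,n}.  If v has many neighbours in a
   connected set A, then either A splits into many connected pieces, each with
   three neighbours of v, which gives a fan at v, or some c in A sees many
   disjoint connected pieces, each with a neighbour of v, which gives a K_{2,n}.
   Cutting both sides in this way shows that there are also few edges between
   disjoint connected sets.  Now take P minimal among the connected sets that
   contain a theta and whose removal does not disconnect their component.  For a
   suitable c in P all components of P - c are theta-free; those that form a
   theta with c are few, and few edges join each of them to c, so making them
   separate parts is cheap, and so is cutting P off.  As each step consumes one
   of boundedly many disjoint thetas, this partitions G at bounded cost. *)
Require Import Defs.
From Stdlib Require Import Classical.
From mathcomp Require Import all_boot zify.

Set Implicit Arguments.
Unset Strict Implicit.
Unset Printing Implicit Defensive.

(** * Connectivity inside a vertex set *)

Section Connectivity.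
Variables (V : finType) (G : graph V).
Implicit Types (A B P Q S : {set V}) (x y z c : V).

(** The adjacency of the subgraph induced on [A], kept as a relation on all of [V] so that [A] can
    vary freely. As [connect] is reflexive outside [A] too, [component] tests membership in [A]. *)
Definition within A : rel V := [rel x y | [&& x \in A, y \in A & G x y]].

Definition conn A := forall x y, x \in A -> y \in A -> connect (within A) x y.

Definition component A x : {set V} := [set y in A | connect (within A) x y].

Definition components A : {set {set V}} := equivalence_partition (connect (within A)) A.

Lemma within_sym A : connect_sym (within A).
Proof.
by apply: sym_connect_sym => x y; rewrite /within /= adj_sym andbCA.
Qed.

Lemma within_mono A B x y :
  A \subset B -> connect (within A) x y -> connect (within B) x y.
Proof.
move=> /subsetP sAB; apply: connect_sub => u v /and3P[uA vA Guv].
by apply: connect1; rewrite /within /= !sAB.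
Qed.

Lemma conn_hub A x : (forall y, y \in A -> connect (within A) x y) -> conn A.
Proof.
move=> hx y z yA zA; apply: connect_trans (hx z zA).
by rewrite within_sym hx.
Qed.

Lemma conn0 : conn set0.
Proof. by move=> x y; rewrite inE. Qed.

Lemma conn1 x : conn [set x].
Proof.
by move=> y z; rewrite !inE => /eqP-> /eqP->. Qed.

Lemma connU A B x : conn A -> conn B -> x \in A -> x \in B -> conn (A :|: B).
Proof.
move=> cA cB xA xB; apply: (@conn_hub _ x) => y /setUP[yA|yB].
  by apply: within_mono (cA _ _ xA yA); apply: subsetUl.
by apply: within_mono (cB _ _ xB yB); apply: subsetUr.
Qed.

Lemma connU_adj A B x y :
  conn A -> conn B -> x \in A -> y \in B -> G x y -> conn (A :|: B).
Proof.
move=> cA cB xA yB Gxy; apply: (@conn_hub _ x) => z /setUP[zA|zB].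
  by apply: within_mono (cA _ _ xA zA); apply: subsetUl.
apply: (@connect_trans _ _ y); last first.
  by apply: within_mono (cB _ _ yB zB); apply: subsetUr.
by apply: connect1; rewrite /within /= !inE xA yB orbT.
Qed.

Lemma conn_path x p : path G x p -> conn [set y in x :: p].
Proof.
elim: p x => [|y p IH] x /=.
  have -> : [set y in [:: x]] = [set x] by apply/setP=> y; rewrite !inE.
  by move=> _; apply: conn1.
case/andP=> Gxy /IH cp; have -> : [set z in [:: x, y & p]] = [set x] :|: [set z in y :: p].
  by apply/setP=> z; rewrite !inE.
by apply: (connU_adj (@conn1 x) cp _ _ Gxy); rewrite !inE eqxx.
Qed.

Lemma connect_path A x y : x \in A -> connect (within A) x y ->
  exists p, [/\ path G x p, y = last x p, uniq (x :: p) & {subset x :: p <= A}].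
Proof.
move=> xA /connectP[p pth ->]; case/shortenP: pth => p' pth' up' _.
exists p'; split=> //; first by apply: sub_path pth' => u v /and3P[].
have: path (within A) x p' -> {subset p' <= A}.
  elim: p' x {up' xA pth'} => //= z p' IH x /andP[/and3P[_ zA _] /IH h] w.
  by rewrite inE => /predU1P[->//|/h].
by move=> /(_ pth') h z; rewrite inE => /predU1P[->//|/h].
Qed.

Lemma within_eqrel A : {in A & &, equivalence_rel (connect (within A))}.
Proof.
move=> x y z _ _ _; split; first exact: connect0.
move=> cxy; apply/idP/idP; last exact: connect_trans.
by apply: connect_trans; rewrite within_sym.
Qed.

Lemma components_partition A : partition (components A) A.
Proof. exact/equivalence_partitionP/within_eqrel. Qed.

Lemma componentsP A Q :
  reflect (exists2 x, x \in A & Q = component A x) (Q \in components A).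
Proof. exact: imsetP. Qed.

Lemma component_self A x : x \in A -> x \in component A x.
Proof. by rewrite inE connect0 andbT. Qed.

Lemma component_sub A x : component A x \subset A.
Proof. by apply/subsetP=> y; rewrite inE => /andP[]. Qed.

Lemma component_eq A x y :
  connect (within A) x y -> component A x = component A y.
Proof.
move=> cxy; apply/setP=> z; rewrite !inE; case: (z \in A) => //=.
apply/idP/idP; last exact: connect_trans.
by apply: connect_trans; rewrite within_sym.
Qed.

Lemma component_max A B x :
  conn B -> B \subset A -> x \in B -> B \subset component A x.
Proof.
move=> cB sBA xB; apply/subsetP=> y yB; rewrite inE (subsetP sBA) //=.
exact: within_mono (cB x y xB yB).
Qed.

Lemma component_conn A x : x \in A -> conn (component A x).
Proof.
move=> xA; apply: (@conn_hub _ x) => y; rewrite inE => /andP[yA].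
case/(connect_path xA)=> p [pth -> _ psub].
have xp : x \in [set z in x :: p] by rewrite !inE eqxx.
have cp := conn_path pth.
have sub : [set z in x :: p] \subset A by apply/subsetP=> z; rewrite inE => /psub.
apply: within_mono (component_max cp sub xp) _.
by apply: cp => //; rewrite inE mem_last.
Qed.

Lemma component_closed A x y z :
  y \in component A x -> z \in A -> G y z -> z \in component A x.
Proof.
rewrite !inE => /andP[yA cxy] zA Gyz; rewrite zA /=.
by apply: connect_trans cxy _; apply: connect1; rewrite /within /= yA zA.
Qed.

(** A simple path in [P] from [x] to [c] meets [c] only at its end, so the vertex before [c] still
    lies in the component of [x]. *)
Lemma conn_neighbour P c x : conn P -> c \in P -> x \in P :\ c ->
  exists2 u, u \in component (P :\ c) x & G c u.
Proof.
move=> cP cPc; rewrite !inE => /andP[xc xP].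
have [p [pth ce up psub]] := connect_path xP (cP _ _ xP cPc).
case/lastP: p => [|p z] in pth ce up psub *; first by rewrite ce eqxx in xc.
rewrite last_rcons in ce; subst z; rewrite rcons_path in pth.
case/andP: pth => pth Glast; exists (last x p); last by rewrite adj_sym.
have xp : x \in [set z in x :: p] by rewrite !inE eqxx.
have sub : [set z in x :: p] \subset P :\ c.
  apply/subsetP=> z; rewrite !inE -in_cons => zp.
  rewrite psub; last by move: zp; rewrite !inE mem_rcons inE orbCA => ->; rewrite orbT.
  rewrite andbT; apply: contraTneq zp => ->.
  by move: up; rewrite -rcons_cons rcons_uniq => /andP[].
by apply: (subsetP (component_max (conn_path pth) sub xp)); rewrite inE mem_last.
Qed.

(** The edge at which a path from [P] to [A :\: P] first leaves [P]. *)
Lemma conn_boundary A P : conn A -> P \subset A -> P != set0 -> A :\: P != set0 ->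
  exists c u, [/\ c \in P, u \in A :\: P & G c u].
Proof.
move=> cA sPA /set0Pn[x xP] /set0Pn[y yAP].
have yA : y \in A by case/setDP: yAP.
have [p [pth ye _ psub]] := connect_path (subsetP sPA _ xP) (cA _ _ (subsetP sPA _ xP) yA).
have lastNP : last x p \notin P by rewrite -ye; case/setDP: yAP.
elim: p x xP pth psub lastNP {ye} => [|z p IH] x xP /=; first by rewrite xP.
case/andP=> Gxz pth psub lst; have [zP|zNP] := boolP (z \in P).
  by apply: (IH z) => // w wp; apply: psub; rewrite inE wp orbT.
by exists x, z; split=> //; rewrite inE zNP psub // !inE eqxx orbT.
Qed.

(* A connected set with connected complement in [A], minimal with property
   [Phi]: a component of [P :\ c] again has connected complement, as [c] is
   adjacent to [A :\: P] and to all the other components. *)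
Lemma conn_cut (Phi : {set V} -> Prop) A : conn A -> Phi A -> ~ Phi set0 ->
  exists P c, [/\ P \subset A, c \in P, conn P, conn (A :\: P) &
    Phi P /\ forall Q, Q \in components (P :\ c) -> ~ Phi Q].
Proof.
move=> cA PhiA Phi0.
suff gen n P : #|P| <= n -> P \subset A -> conn P -> conn (A :\: P) -> Phi P ->
    exists P c, [/\ P \subset A, c \in P, conn P, conn (A :\: P) &
      Phi P /\ forall Q, Q \in components (P :\ c) -> ~ Phi Q].
  by apply: (gen #|A| A) => //; rewrite setDv; apply: conn0.
elim: n P => [|n IH] P Pn sPA cP cAP PhiP.
  by move: Pn; rewrite leqn0 cards_eq0 => /eqP P0; case: Phi0; rewrite -P0.
have P0 : P != set0 by apply/eqP=> P0; case: Phi0; rewrite -P0.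
(* [c] is the inner end of an edge leaving [P]; if [P = A], any vertex serves. *)
have [c cPc cadj] : exists2 c, c \in P &
    A :\: P = set0 \/ exists2 u, u \in A :\: P & G c u.
  have [AP0|AP0] := eqVneq (A :\: P) set0.
    by case/set0Pn: P0 => c; exists c => //; left.
  by have [c [u [? ? ?]]] := conn_boundary cA sPA P0 AP0; exists c => //; right; exists u.
have [[Q [QC PhiQ]]|noQ] := classic (exists Q, Q \in components (P :\ c) /\ Phi Q); last first.
  exists P, c; split=> //; split=> // Q QC PhiQ; apply: noQ; by exists Q.
case/componentsP: QC => x xPc Qe; subst Q.
have sQP : component (P :\ c) x \subset P :\ c by apply: component_sub.
have cNQ : c \notin component (P :\ c) x by apply: contraL cPc => /(subsetP sQP); rewrite !inE eqxx.
have sQA : component (P :\ c) x \subset A.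
  by apply: subset_trans sQP _; apply: subset_trans (subD1set _ _) sPA.
apply: (IH (component (P :\ c) x)) => //.
- rewrite -ltnS; apply: leq_trans Pn; apply: proper_card; apply/properP; split.
    exact: subset_trans sQP (subD1set _ _).
  by exists c.
- exact: component_conn.
apply: (@conn_hub _ c) => z /setDP[zA zNQ].
have sAP : A :\: P \subset A :\: component (P :\ c) x.
  by apply: setDS; apply: subset_trans sQP (subD1set _ _).
have cA' : c \in A :\: component (P :\ c) x by rewrite inE cNQ (subsetP sPA).
have [zP|zNP] := boolP (z \in P); last first.
  have zAP : z \in A :\: P by rewrite inE zNP.
  case: cadj => [AP0|[u uAP Gcu]]; first by rewrite AP0 inE in zAP.
  apply: (@connect_trans _ _ u); last exact: within_mono sAP (cAP _ _ uAP zAP).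
  by apply: connect1; rewrite /within /= cA' (subsetP sAP).
have [->|zc] := eqVneq z c; first exact: connect0.
have zPc : z \in P :\ c by rewrite !inE zc.
have [u uz Gcu] := conn_neighbour cP cPc zPc.
have sub : component (P :\ c) z \subset A :\: component (P :\ c) x.
  apply/subsetP=> w wz; rewrite inE (subsetP sPA); last first.
    by move/(subsetP (component_sub _ _)): wz; rewrite inE => /andP[].
  rewrite andbT; apply: contraNN zNQ => wx.
  suff -> : component (P :\ c) x = component (P :\ c) z by apply: component_self.
  move: wx wz; rewrite !inE => /andP[_ xw] /andP[_ zw].
  by rewrite (component_eq xw) (component_eq zw).
apply: (@connect_trans _ _ u).
  by apply: connect1; rewrite /within /= cA' (subsetP sub).
by apply: within_mono sub _; apply: (component_conn zPc) => //; apply: component_self.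
Qed.

End Connectivity.

(** * Theta graphs *)

Section Theta.
Variables (V : finType) (G : graph V).
Implicit Types (A B P Q S T U X Y : {set V}) (x y z c a b : V) (p q : seq V).

(** The lists hold internal vertices only; the single [uniq] gives distinct ends and internal
    disjointness at once. *)
Definition three_paths a b p1 p2 p3 :=
  [/\ path G a (rcons p1 b), path G a (rcons p2 b), path G a (rcons p3 b) &
      uniq [:: a, b & p1 ++ p2 ++ p3]].

(** In a simple graph at most one of the three paths is a single edge; by convention that is
    [p3]. *)
Definition theta X := exists a b p1 p2 p3,
  [/\ three_paths a b p1 p2 p3, p1 != [::], p2 != [::] &
      {subset [:: a, b & p1 ++ p2 ++ p3] <= X}].

Lemma theta_mono X Y : X \subset Y -> theta X -> theta Y.
Proof.
move=> /subsetP sXY [a [b [p1 [p2 [p3 [h n1 n2 sub]]]]]].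
by exists a, b, p1, p2, p3; split=> // x /sub/sXY.
Qed.

Lemma theta0 : ~ theta set0.
Proof.
move=> [a [b [p1 [p2 [p3 [_ _ _ sub]]]]]].
by have := sub a; rewrite !inE eqxx => /(_ isT).
Qed.

Lemma three_paths_perm a b p1 p2 p3 q1 q2 q3 :
  perm_eq [:: p1; p2; p3] [:: q1; q2; q3] ->
  three_paths a b p1 p2 p3 -> three_paths a b q1 q2 q3.
Proof.
move=> pq [h1 h2 h3 un].
have h q : q \in [:: q1; q2; q3] -> path G a (rcons q b).
  by rewrite -(perm_mem pq) !inE => /or3P[] /eqP->.
split; try by apply: h; rewrite !inE eqxx ?orbT.
rewrite -(@perm_uniq _ [:: a, b & p1 ++ p2 ++ p3]) // !perm_cons.
have := perm_flatten pq; by rewrite /= !cats0.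
Qed.

(** The possible single edge may be any of the three paths; reordering makes it the third. *)
Lemma theta_intro X a b p1 p2 p3 : three_paths a b p1 p2 p3 ->
  (p1 == [::]) + (p2 == [::]) + (p3 == [::]) <= 1 ->
  {subset [:: a, b & p1 ++ p2 ++ p3] <= X} -> theta X.
Proof.
move=> h cnt sub.
have done q1 q2 q3 : perm_eq [:: p1; p2; p3] [:: q1; q2; q3] ->
    q1 != [::] -> q2 != [::] -> theta X.
  move=> pq n1 n2; exists a, b, q1, q2, q3; split=> //.
    exact: three_paths_perm pq h.
  move=> x xq; apply: sub; rewrite (@perm_mem _ _ [:: a, b & q1 ++ q2 ++ q3]) // !perm_cons.
  by have := perm_flatten pq; rewrite /= !cats0.
have [n1|n1] := boolP (p1 == [::]).
  rewrite n1 in cnt; apply: (done p2 p3 p1); try lia.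
  by apply/permP=> f /=; clear; lia.
have [n2|n2] := boolP (p2 == [::]); last exact: (done p1 p2 p3).
rewrite n2 in cnt; apply: (done p1 p3 p2) => //; try lia.
by apply/permP=> f /=; clear; lia.
Qed.

(** Each path without [a] is still connected and contains [b]. *)
Lemma three_paths_conn_del_branch a b p1 p2 p3 : three_paths a b p1 p2 p3 ->
  conn G ([set x in [:: a, b & p1 ++ p2 ++ p3]] :\ a).
Proof.
case=> h1 h2 h3 un.
have tail p : path G a (rcons p b) -> conn G [set x in rcons p b].
  case: p => [|x p] /=; last by case/andP=> _ /(@conn_path _ G).
  by move=> _; have -> : [set x in [:: b]] = [set b]; [apply/setP=> x; rewrite !inE | apply: conn1].
have -> : [set x in [:: a, b & p1 ++ p2 ++ p3]] :\ a =
    [set x in rcons p1 b] :|: [set x in rcons p2 b] :|: [set x in rcons p3 b].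
  apply/setP=> x; rewrite !inE !mem_rcons !inE !mem_cat.
  case: eqP => [->|_] /=; last by do ![case: (x \in _)]; case: (x == b).
  move: un; rewrite /= !inE !mem_cat !negb_or => /andP[] /and4P[/negPf-> /negPf-> /negPf-> /negPf->].
  by [].
apply: (@connU _ _ _ _ b); try apply: (@connU _ _ _ _ b); try exact: tail;
  by rewrite !inE ?mem_rcons ?inE ?eqxx.
Qed.

Lemma three_paths_sym a b p1 p2 p3 : three_paths a b p1 p2 p3 ->
  three_paths b a (rev p1) (rev p2) (rev p3).
Proof.
case=> h1 h2 h3 un.
have rv p : path G a (rcons p b) -> path G b (rcons (rev p) a).
  move=> h; have := rev_path G a (rcons p b).
  rewrite last_rcons belast_rcons rev_cons => ->.
  by rewrite (eq_path (e' := G)) // => x y; rewrite adj_sym.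
split; try exact: rv.
rewrite -(@perm_uniq _ [:: a, b & p1 ++ p2 ++ p3]) //.
rewrite (perm_catCA [:: a] [:: b]) /= !perm_cons.
by rewrite !perm_cat // perm_sym perm_rev.
Qed.

(** The other two paths stay intact and meet in [a]; the two pieces of the first path hang on [a]
    and on [b]. *)
Lemma three_paths_conn_del_first a b p1 p2 p3 c : three_paths a b p1 p2 p3 ->
  c \in p1 -> conn G ([set x in [:: a, b & p1 ++ p2 ++ p3]] :\ c).
Proof.
case=> h1 h2 h3 un cp1.
have cfull p : path G a (rcons p b) -> conn G [set x in a :: rcons p b].
  exact: conn_path.
case/splitPr: cp1 h1 un => s t h1 un.
have -> : [set x in [:: a, b & (s ++ c :: t) ++ p2 ++ p3]] :\ c =
    [set x in a :: rcons p2 b] :|: [set x in a :: rcons p3 b] :|: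
    [set x in a :: s] :|: [set x in rcons t b].
  apply/setP=> x; rewrite !inE !mem_rcons !mem_cat !inE.
  case: eqP => [->|_] /=; last first.
    by do ![case: (x \in _)]; case: (x == a); case: (x == b).
  have : uniq (c :: [:: a, b & s ++ t ++ p2 ++ p3]).
    rewrite -(@perm_uniq _ [:: a, b & (s ++ c :: t) ++ p2 ++ p3]) //.
    by apply/permP=> f; rewrite /= !count_cat /=; clear; lia.
  rewrite cons_uniq !inE !mem_cat !negb_or => /andP[/and5P[ca cb cs ct /andP[cp2 cp3]] _].
  by rewrite (negPf ca) (negPf cb) (negPf cs) (negPf ct) (negPf cp2) (negPf cp3).
have [hs ht] : path G a s /\ path G c (rcons t b).
  by move: h1; rewrite rcons_cat cat_path rcons_cons /= => /and3P[].
apply: (@connU _ _ _ _ b); last 2 first.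
- by rewrite !inE !mem_rcons !inE eqxx !orbT.
- by rewrite !inE !mem_rcons !inE eqxx.
- apply: (@connU _ _ _ _ a); first apply: (@connU _ _ _ _ a).
  + exact: cfull.
  + exact: cfull.
  + by rewrite !inE eqxx.
  + by rewrite !inE eqxx.
  + exact: conn_path.
  + by rewrite !inE eqxx.
  + by rewrite !inE eqxx.
case: t ht {h1 un} => [|x t] /=; last by case/andP=> _ /(@conn_path _ G).
by move=> _; have -> : [set x in [:: b]] = [set b]; [apply/setP=> x; rewrite !inE | apply: conn1].
Qed.

(** A theta has no cut vertex. Reversing or permuting the paths brings [c] to the first branch
    vertex or to the first path; a [c] off the theta removes nothing. *)
Lemma three_paths_conn_del a b p1 p2 p3 c : three_paths a b p1 p2 p3 ->
  conn G ([set x in [:: a, b & p1 ++ p2 ++ p3]] :\ c).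
Proof.
move=> h.
have same q1 q2 q3 : perm_eq [:: p1; p2; p3] [:: q1; q2; q3] ->
    [set x in [:: a, b & p1 ++ p2 ++ p3]] = [set x in [:: a, b & q1 ++ q2 ++ q3]].
  move=> pq; apply/setP=> x; rewrite !inE.
  by have := perm_mem (perm_flatten pq) x; rewrite /= !cats0 => ->.
have [->|ca] := eqVneq c a; first exact: three_paths_conn_del_branch h.
have [->|cb] := eqVneq c b.
  have := three_paths_conn_del_branch (three_paths_sym h).
  congr (conn G (_ :\ _)); apply/setP=> x; rewrite !inE !mem_cat !mem_rev.
  by rewrite orbCA.
have [c1|c1] := boolP (c \in p1); first exact: three_paths_conn_del_first h c1.
have [c2|c2] := boolP (c \in p2).
  have pq : perm_eq [:: p1; p2; p3] [:: p2; p1; p3] by apply/permP=> f /=; clear; lia.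
  by rewrite (same _ _ _ pq); apply: three_paths_conn_del_first (three_paths_perm pq h) c2.
have [c3|c3] := boolP (c \in p3).
  have pq : perm_eq [:: p1; p2; p3] [:: p3; p1; p2] by apply/permP=> f /=; clear; lia.
  by rewrite (same _ _ _ pq); apply: three_paths_conn_del_first (three_paths_perm pq h) c3.
have -> : [set x in [:: a, b & p1 ++ p2 ++ p3]] :\ c =
    [set x in a :: rcons p1 b] :|: [set x in a :: rcons p2 b] :|: [set x in a :: rcons p3 b].
  apply/setP=> x; rewrite !inE !mem_rcons !inE !mem_cat.
  case: (eqVneq x c) => [->|_] /=.
    by rewrite (negPf ca) (negPf cb) (negPf c1) (negPf c2) (negPf c3).
  by do ![case: (x \in _)]; case: (x == a); case: (x == b).
case: h => h1 h2 h3 _.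
by apply: (@connU _ _ _ _ a); first apply: (@connU _ _ _ _ a); rewrite ?inE ?eqxx //; apply: conn_path.
Qed.

(** As a theta has no cut vertex, what remains of it without [c] is connected and so lies in one
    component of [U :\ c]. *)
Lemma theta_component_del c U : theta (c |: U) ->
  exists2 Q, Q \in components G (U :\ c) & theta (c |: Q).
Proof.
case=> a [b [p1 [p2 [p3 [h n1 n2 sub]]]]].
set T := [set x in [:: a, b & p1 ++ p2 ++ p3]].
have cT : conn G (T :\ c) := three_paths_conn_del h.
have [x xT] : exists x, x \in T :\ c.
  have ab : a != b by case: h => _ _ _; rewrite /= !inE negb_or => /andP[/andP[]].
  have [ac|ca] := eqVneq a c; first by exists b; rewrite !inE -ac eq_sym ab eqxx orbT.
  by exists a; rewrite !inE ca eqxx.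
have sTU : T :\ c \subset U :\ c.
  apply/subsetP=> y /setD1P[yc]; rewrite inE => /sub /setU1P[yc'|yU].
    by rewrite yc' eqxx in yc.
  by rewrite !inE yc.
exists (component G (U :\ c) x).
  by apply/componentsP; exists x => //; apply: (subsetP sTU).
exists a, b, p1, p2, p3; split=> // y yT.
have := subsetP (component_max cT sTU xT) y; rewrite in_setU1.
case: eqVneq => //= yc -> //; by rewrite in_setD1 yc inE.
Qed.

Lemma theta_component U : theta U -> exists2 Q, Q \in components G U & theta Q.
Proof.
case=> a [b [p1 [p2 [p3 [h n1 n2 sub]]]]].
set T := [set x in [:: a, b & p1 ++ p2 ++ p3]].
have cT : conn G T.
  have [x x1] : exists x, x \in p1 by case: (p1) n1 => // x s _; exists x; rewrite inE eqxx.
  have [y y2] : exists y, y \in p2 by case: (p2) n2 => // y s _; exists y; rewrite inE eqxx.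
  have un : uniq [:: a, b & p1 ++ p2 ++ p3] by case: h.
  (* The theta is connected as the union of two connected vertex-deleted thetas that share [a]. *)
  have -> : T = T :\ x :|: T :\ y.
    apply/setP=> z; rewrite !inE -andb_orl -negb_and.
    case: (eqVneq z x) => //= ->; case: (eqVneq x y) => //= xy.
    move: un; rewrite /= !cat_uniq mem_cat => /and3P[_ _ /and3P[_ /hasPn/(_ y)]].
    by rewrite mem_cat y2 -xy x1 => /(_ isT).
  apply: (@connU _ _ _ _ a); try exact: three_paths_conn_del h;
    rewrite !inE eqxx andbT; apply: contraTneq un => ->; rewrite /= !inE !mem_cat ?x1 ?y2 ?orbT //.
have sTU : T \subset U by apply/subsetP=> y; rewrite inE => /sub.
have aT : a \in T by rewrite !inE eqxx.
exists (component G U a); first by apply/componentsP; exists a => //; apply: (subsetP sTU).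
exists a, b, p1, p2, p3; split=> // y yT.
by apply: (subsetP (component_max cT sTU aT)); rewrite inE.
Qed.

(** A path from [x] is followed up to its first vertex [z] in [S] and read backwards; it then meets
    [S] only in [z]. *)
Lemma connect_set A S x y : y \in S -> x \in A -> connect (within G A) x y ->
  exists z p, [/\ z \in S, path G z p, last z p = x, uniq (z :: p) &
    {subset z :: p <= A} /\ ~~ has (mem S) p].
Proof.
move=> yS xA /(connect_path xA)[q [qp ye _ qsub]]; subst y.
suff [z [p [zS pth pl psub pS]]] : exists z p, [/\ z \in S, path G z p, last z p = x,
    {subset z :: p <= A} & ~~ has (mem S) p].
  move: pl; case/shortenP: pth => p' pth' up' sub' pl.
  exists z, p'; split=> //; split.
    by move=> w; rewrite inE => /predU1P[->|/sub' wp]; apply: psub; rewrite inE ?eqxx // wp orbT.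
  by apply: contraNN pS => /hasP[w /sub' wp wS]; apply/hasP; exists w.
elim: q x {xA} qp qsub yS => [|w q IH] x /=.
  by move=> _ xA xS; exists x, [::]; split=> //.
case/andP=> Gxw qp qsub yS; have [xS|xS] := boolP (x \in S).
  by exists x, [::]; split=> // u; rewrite inE => /eqP->; apply: qsub; rewrite inE eqxx.
have qsub' : {subset w :: q <= A} by move=> u uq; apply: qsub; rewrite inE uq orbT.
have [z [p [zS pth pl psub pS]]] := IH w qp qsub' yS.
exists z, (rcons p x); split=> //.
- by rewrite rcons_path pth pl adj_sym.
- by rewrite last_rcons.
- move=> u; rewrite -rcons_cons mem_rcons inE => /predU1P[->|/psub//].
  by apply: qsub; rewrite inE eqxx.
by rewrite has_rcons negb_or pS andbT.
Qed.

(** A path from [a1] to [a2] and a path from [a3] to its first contact [x] with it form three legs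
    from [x]; legs may be empty. *)
Lemma tripod A a1 a2 a3 : conn G A -> a1 \in A -> a2 \in A -> a3 \in A ->
  exists x p1 p2 p3, [/\ [/\ path G x p1, path G x p2 & path G x p3],
    [/\ last x p1 = a1, last x p2 = a2 & last x p3 = a3],
    uniq (x :: p1 ++ p2 ++ p3) & {subset x :: p1 ++ p2 ++ p3 <= A}].
Proof.
move=> cA a1A a2A a3A.
have [p [pp pe pu psub]] := connect_path a1A (cA _ _ a1A a2A).
have a1S : a1 \in [set z in a1 :: p] by rewrite !inE eqxx.
have [x [p3 [xS pth3 pl3 pu3 [psub3 pS3]]]] := connect_set a1S a3A (cA _ _ a3A a1A).
have hp3 z : z \in p3 -> z \notin a1 :: p.
  by move=> zp; have := hasPn pS3 z zp; rewrite /= inE.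
move: xS; rewrite inE => xS.
have [s [t [st ps pt ls lt]]] : exists s t, [/\ perm_eq (a1 :: p) (x :: s ++ t),
    path G x s, path G x t, last x s = a1 & last x t = a2].
  move: xS; rewrite inE => /predU1P[xa|xp].
    by exists [::], p; split=> //=; rewrite xa.
  case/splitPr: xp pp pe {pu psub hp3 pS3 a1S} => s t pp pe.
  exists (rev (a1 :: s)), t; split.
  - apply/permP=> f /=; rewrite !count_cat /= count_rev /=; clear; lia.
  - move: pp; rewrite -cat_rcons cat_path => /andP[pp _].
    have := rev_path G a1 (rcons s x); rewrite last_rcons belast_rcons.
    by rewrite (eq_path (e' := G)) => [->|u v]; rewrite // adj_sym.
  - by move: pp; rewrite cat_path /= => /and3P[].
  - by rewrite rev_cons last_rcons.
  - by rewrite pe last_cat.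
exists x, s, t, p3; split=> //.
  have us : uniq (x :: s ++ t) by rewrite -(perm_uniq st).
  rewrite catA -cat_cons cat_uniq us /=.
  move: pu3 => /= /andP[_ ->]; rewrite andbT.
  by apply/hasPn=> z /hp3; rewrite (perm_mem st).
move=> z; rewrite catA -cat_cons mem_cat => /orP[].
  by rewrite -(perm_mem st) => /psub.
by move=> zp; apply: psub3; rewrite inE zp orbT.
Qed.

(** A tripod on the ends in [A] and one on the ends in [B], joined by the three edges, form a theta
    between the two centres. *)
Lemma three_edges_theta A B : conn G A -> conn G B -> [disjoint A & B] ->
  2 < #|[set e : V * V | [&& e.1 \in A, e.2 \in B & G e.1 e.2]]| -> theta (A :|: B).
Proof.
move=> cA cB dAB /card_gt2P[[a1 b1] [[a2 b2] [[a3 b3] [[h1 h2 h3] [n12 n23 n31]]]]].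
move: h1 h2 h3; rewrite !inE /= => /and3P[a1A b1B G1] /and3P[a2A b2B G2] /and3P[a3A b3B G3].
have [x [p1 [p2 [p3 [[pp1 pp2 pp3] [l1 l2 l3] up subp]]]]] := tripod cA a1A a2A a3A.
have [y [q1 [q2 [q3 [[pq1 pq2 pq3] [m1 m2 m3] uq subq]]]]] := tripod cB b1B b2B b3B.
have join p q a b : path G x p -> path G y q -> last x p = a -> last y q = b ->
    G a b -> path G x (rcons (p ++ rev q) y).
  move=> hp hq la lb Gab; rewrite rcons_cat cat_path hp la -rev_cons.
  rewrite lastI rev_rcons /= lb Gab /=.
  have := rev_path G y q; rewrite lb => ->.
  by rewrite (eq_path (e' := G)) // => u v; rewrite adj_sym.
have pe : perm_eq [:: x, y & (p1 ++ rev q1) ++ (p2 ++ rev q2) ++ p3 ++ rev q3]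
                  ((x :: p1 ++ p2 ++ p3) ++ (y :: q1 ++ q2 ++ q3)).
  apply/permP=> f; rewrite /= !count_cat /= !count_cat !count_rev; clear; lia.
apply: (@theta_intro _ x y (p1 ++ rev q1) (p2 ++ rev q2) (p3 ++ rev q3)).
- split; try by apply: join; eassumption.
  rewrite (perm_uniq pe) cat_uniq up uq andbT.
  by apply/hasPn=> z /subq zB; apply: contraTN zB => /subp zA; rewrite (disjointFr dAB).
(* A path without internal vertices is the edge [xy] itself; as the three edges are distinct, this
   occurs at most once. *)
- have nilE p q a b : last x p = a -> last y q = b -> p ++ rev q == [::] -> (a, b) = (x, y).
    rewrite -size_eq0 size_cat size_rev addn_eq0 !size_eq0 => <- <- /andP[/eqP-> /eqP->].
    by [].
  have e1 := nilE _ _ _ _ l1 m1; have e2 := nilE _ _ _ _ l2 m2; have e3 := nilE _ _ _ _ l3 m3.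
  case: eqVneq => [/eqP/e1 h1|_]; case: eqVneq => [/eqP/e2 h2|_];
    case: eqVneq => [/eqP/e3 h3|_] //=.
  + by rewrite h1 h2 eqxx in n12.
  + by rewrite h1 h2 eqxx in n12.
  + by rewrite h3 h1 eqxx in n31.
  + by rewrite h2 h3 eqxx in n23.
- move=> z; rewrite (perm_mem pe) mem_cat in_setU => /orP[/subp->//|/subq->].
  by rewrite orbT.
Qed.

End Theta.

(** * Edges between connected sets *)

Notation disjoint_seq := (pairwise (fun X Y : {set _} => [disjoint X & Y])).

Section Packing.
Variables (V : finType) (G : graph V).
Implicit Types (A B P Q S T U X Y : {set V}) (x y z c v : V) (w : V -> nat).
Implicit Types (Ps Qs Xs : seq {set V}).

(** Neighbours of a vertex [v] are counted by the weight [G v], edges into a set [B] by the weight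
    [deg B], so that one splitting lemma serves both. *)
Definition weight w A := \sum_(x in A) w x.
Definition deg A x := \sum_(y in A) (G x y : nat).
Definition edges_between A B := weight (deg B) A.

(** The theta may or may not use [v], so this bounds packings of disjoint thetas as well as fans of
    thetas that share [v]. *)
Definition few_thetas N := forall v Xs, disjoint_seq Xs ->
  (forall X, X \in Xs -> theta G (v |: X)) -> size Xs < N.

(** Each [Q] contains a path between a neighbour of [x] and one of [y], so [K] such sets give a
    subdivided [K_{2,K}]. *)
Definition few_links K := forall x y Qs, x != y -> disjoint_seq Qs ->
  (forall Q, Q \in Qs -> [/\ x \notin Q, y \notin Q, conn G Q,
     exists2 u, u \in Q & G x u & exists2 u, u \in Q & G y u]) ->
  size Qs < K.

(** Bounds the number of weighted pieces around a centre [c]; for the weight [G v] such pieces link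
    [c] and [v]. *)
Definition star_free w A d := forall c Qs, c \in A -> disjoint_seq Qs ->
  (forall Q, Q \in Qs -> [/\ Q \subset A, c \notin Q, conn G Q,
     exists2 u, u \in Q & G c u & 0 < weight w Q]) ->
  size Qs < d.

Lemma weight0 w : weight w set0 = 0.
Proof. exact: big_set0. Qed.

Lemma weightD w A P : P \subset A -> weight w A = weight w P + weight w (A :\: P).
Proof.
by move=> sPA; rewrite /weight (big_setID P) /= (setIidPr sPA).
Qed.

Lemma weight_sub w A B : A \subset B -> weight w A <= weight w B.
Proof. by move/(weightD w)=> ->; apply: leq_addr. Qed.

Lemma weightU w A B : [disjoint A & B] -> weight w (A :|: B) = weight w A + weight w B.
Proof.
move=> dAB; rewrite (weightD w (subsetUl A B)); congr (_ + weight w _).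
by rewrite setDUl setDv set0U; apply/setDidPl; rewrite disjoint_sym.
Qed.

Lemma weight_gt0 w A : 0 < weight w A -> exists2 x, x \in A & 0 < w x.
Proof.
rewrite lt0n sum_nat_eq0 negb_forall => /existsP[x]; rewrite negb_imply -lt0n.
by case/andP; exists x.
Qed.

Lemma deg_gt0 A x : 0 < deg A x -> exists2 y, y \in A & G x y.
Proof. by case/(weight_gt0 (w := fun y => G x y)) => y yA; rewrite lt0b; exists y. Qed.

Lemma deg_adj A x y : y \in A -> G x y -> 0 < deg A x.
Proof. by move=> yA Gxy; rewrite /deg (bigD1 y) //= Gxy. Qed.

Lemma edges_betweenC A B : edges_between A B = edges_between B A.
Proof.
rewrite /edges_between /weight /deg exchange_big /=.
by apply: eq_bigr => y _; apply: eq_bigr => x _; rewrite adj_sym.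
Qed.

Lemma edges_between_card A B :
  edges_between A B = #|[set e : V * V | [&& e.1 \in A, e.2 \in B & G e.1 e.2]]|.
Proof.
rewrite /edges_between /weight /deg pair_big /= -sum1_card big_mkcond [RHS]big_mkcond.
by apply: eq_bigr => -[x y] _; rewrite inE /=; do 3!case: (_ \in _) => //=; case: (G x y).
Qed.

Lemma edges_between_theta A B : conn G A -> conn G B -> [disjoint A & B] ->
  2 < edges_between A B -> theta G (A :|: B).
Proof. by rewrite edges_between_card; apply: three_edges_theta. Qed.

Lemma disjoint_seq_components S (CC : {set {set V}}) :
  CC \subset components G S -> disjoint_seq (enum CC).
Proof.
move=> sCC; have : {subset enum CC <= components G S}.
  by move=> X; rewrite mem_enum => /(subsetP sCC).
case/and3P: (components_partition G S) => _ /trivIsetP tI _.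
elim: (enum CC) (enum_uniq CC) => //= X Xs IH /andP[XXs un] sub.
rewrite IH ?andbT //; last by move=> Y YXs; apply: sub; rewrite inE YXs orbT.
apply/allP=> Y YXs; apply: tI; try by apply: sub; rewrite inE ?eqxx ?YXs ?orbT.
by apply: contraNneq XXs => ->.
Qed.

Lemma component_weight_bound w P c s d : c \in P ->
  (forall Q, Q \in components G (P :\ c) -> weight w Q <= s) ->
  #|[set Q in components G (P :\ c) | 0 < weight w Q]| <= d ->
  weight w P <= w c + d * s.
Proof.
move=> cP ws cd; rewrite /weight (big_setD1 c) // leq_add2l.
case/and3P: (components_partition G (P :\ c)) => /eqP cov tI _; rewrite -{1}cov.
have -> : \sum_(x in cover (components G (P :\ c))) w x =
    \sum_(Q in components G (P :\ c)) weight w Q by rewrite big_trivIset.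
rewrite (bigID (fun Q => 0 < weight w Q)) /=.
rewrite [X in _ + X]big1 ?addn0; last by move=> Q /andP[_]; rewrite -eqn0Ngt => /eqP.
apply: leq_trans (leq_mul cd (leqnn s)); rewrite -sum_nat_const big_mkcond [leqRHS]big_mkcond.
apply: leq_sum => Q _; rewrite !inE; case: ifP => // /andP[QC _].
exact: ws.
Qed.

Lemma component_nbr P c Q : conn G P -> c \in P -> Q \in components G (P :\ c) ->
  [/\ Q \subset P, c \notin Q, conn G Q & exists2 u, u \in Q & G c u].
Proof.
move=> cP cPc /componentsP[x xP ->].
have sub := component_sub G (P :\ c) x.
split; first exact: subset_trans sub (subD1set _ _).
- by apply: contraT => /negPn /(subsetP sub); rewrite !inE eqxx.
- exact: component_conn.
- exact: conn_neighbour.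
Qed.

(** The components of [P :\ c] of positive weight form a star around [c], as each contains a
    neighbour of [c]. *)
Lemma star_free_weight w A P c s d : conn G P -> c \in P -> P \subset A ->
  star_free w A d ->
  (forall Q, Q \in components G (P :\ c) -> weight w Q <= s) ->
  weight w P <= w c + d * s.
Proof.
move=> cP cPc sPA sf ws; apply: (component_weight_bound cPc ws).
set CC := [set _ in _ | _].
have sCC : CC \subset components G (P :\ c) by apply/subsetP=> Q; rewrite inE => /andP[].
apply: ltnW; rewrite cardE; apply: (sf c); first exact: (subsetP sPA).
  exact: disjoint_seq_components sCC.
move=> Q; rewrite mem_enum => QCC; have := QCC; rewrite inE => /andP[QC wQ].
have [sQP cQ cQ' nb] := component_nbr cP cPc QC.
by split=> //; apply: subset_trans sPA.
Qed.

Lemma star_free_sub w A B d : B \subset A -> star_free w A d -> star_free w B d.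
Proof.
move=> sBA sf c Qs cB dQ hQ; apply: (sf c) => //; first exact: (subsetP sBA).
by move=> Q /hQ[? ? ? ? ?]; split=> //; apply: subset_trans sBA.
Qed.

(** Each round cuts off a minimal connected [P] of weight at least [s] with connected rest. By
    minimality the components of [P :\ c] weigh less than [s], so the rest loses at most
    [f + d * s]. *)
Lemma split_weight w s d f n A : 0 < s -> 0 < f -> conn G A ->
  (forall x, x \in A -> w x <= f) -> star_free w A d ->
  n * (f + d * s) <= weight w A ->
  exists Ps, [/\ size Ps = n, disjoint_seq Ps &
    forall P, P \in Ps -> [/\ P \subset A, conn G P & s <= weight w P]].
Proof.
move=> s0 f0; elim: n A => [|n IH] A cA wf sf wA; first by exists [::].
have [A0|[a aA]] := set_0Vmem A.
  by move: wA; rewrite A0 weight0; nia.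
(* The empty star at [a] shows that [d] is positive, hence [f + d * s] is at least [s]. *)
have d0 : 0 < d by apply: (sf a [::]).
have PhiA : s <= weight w A by nia.
have Phi0 : ~ s <= weight w set0 by rewrite weight0; lia.
have [P [c [sPA cP cPc cAP [sP comps]]]] := @conn_cut _ _ (fun X => s <= weight w X) _ cA PhiA Phi0.
have wP : weight w P <= f + d * s.
  apply: leq_trans (leq_add (wf c (subsetP sPA _ cP)) (leqnn _)).
  apply: star_free_weight cPc cP sPA sf _ => Q /comps; lia.
have wAP := weightD w sPA.
have [|||Ps [sz dPs hPs]] := IH (A :\: P) cAP.
- by move=> x /setDP[xA _]; apply: wf.
- exact: star_free_sub (subsetDl _ _) sf.
- by move: wA; rewrite wAP mulSn; lia.
exists (P :: Ps); split=> /=; first by rewrite sz.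
  rewrite dPs andbT; apply/allP=> Q /hPs[sQ _ _].
  by rewrite disjoint_sym; apply: disjointWl sQ _; rewrite disjoints_subset setDE subsetIr.
move=> Q; rewrite inE => /predU1P[->//|/hPs[sQ cQ wQ]].
by split=> //; apply: subset_trans sQ (subsetDl _ _).
Qed.

(** * Edges from a vertex to a connected set, and between two connected sets *)

Section Bounds.
Variables (N K : nat).
Hypotheses (N_gt0 : 0 < N) (thetasN : few_thetas N) (linksK : few_links K).

(** Both bounds are thresholds of [split_weight] for [N] pieces: [hub_bound] with [f = 1], [d = K],
    [s = 3], and [ladder_bound] with [f = d = hub_bound], [s = N * ladder_loss]. The summand 3 keeps
    [ladder_loss] at least 3, the number of edges that forces a theta. *)
Definition hub_bound := N * (1 + K * 3).
Definition ladder_loss := 3 * hub_bound + 3.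
Definition ladder_bound := N * (hub_bound + hub_bound * (N * ladder_loss)).

(** A star of [K] pieces around some [c] would link [c] and [v] too often. So with many neighbours
    of [v], the set [A] splits into [N] connected pieces with three of them each, which is a fan of
    thetas at [v]. *)
Lemma hub A v : conn G A -> v \notin A -> deg A v < hub_bound.
Proof.
move=> cA vA; rewrite ltnNge; apply/negP=> big.
have := @split_weight (fun x => G v x) 3 K 1 N A isT isT cA.
case=> //; [by move=> x _; case: (G v x) | | ].
  move=> c Qs cA' dQ hQ; apply: (linksK (x := c) (y := v)) => //.
    by apply: contraNneq vA => <-.
  move=> Q /hQ[sQA cQ cQ' nb wQ]; split=> //.
    by apply: contra vA => /(subsetP sQA).
  by have [u uQ] := weight_gt0 wQ; rewrite lt0b; exists u.
move=> Ps [sz dPs hPs]; have := thetasN (v := v) dPs; rewrite sz ltnn => h.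
suff: false by []. apply: h => P /hPs[sPA cP wP].
apply: edges_between_theta => //; first exact: conn1.
  by rewrite disjoints1; apply: contra vA => /(subsetP sPA).
by rewrite /edges_between /weight big_set1.
Qed.

(** Every piece sends an edge to [B], so [B] and the pieces together form one connected set without
    [c], in which [c] has a neighbour for each piece; [hub] bounds these. *)
Lemma star B c Qs : conn G B -> c \notin B -> disjoint_seq Qs ->
  (forall Q, Q \in Qs -> [/\ c \notin Q, conn G Q, exists2 u, u \in Q & G c u &
     0 < weight (deg B) Q]) ->
  size Qs < hub_bound.
Proof.
move=> cB cNB dQ hQ.
suff [S [cS cNS sS sB]] : exists S, [/\ conn G (B :|: S), c \notin S, size Qs <= deg S c &
    forall x, x \in S -> exists2 Q, Q \in Qs & x \in Q].
  apply: leq_ltn_trans sS _; apply: leq_ltn_trans (hub cS _).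
    exact: (weight_sub (fun y => G c y) (subsetUr B S)).
  by rewrite inE negb_or cNB.
elim: Qs dQ hQ => [|Q Qs IH] /=.
  by move=> _ _; exists set0; rewrite setU0 inE; split=> // x; rewrite inE.
case/andP=> /allP dQ dQs hQ.
have [|S [cS cNS sS sB]] := IH dQs; first by move=> R RQ; apply: hQ; rewrite inE RQ orbT.
have [cQ cQ' [u uQ Gcu] wQ] := hQ Q (mem_head _ _).
exists (Q :|: S); split.
- have [x xQ /deg_gt0[y yB Gxy]] := weight_gt0 wQ.
  rewrite setUCA setUC; rewrite adj_sym in Gxy.
  by apply: (connU_adj cS cQ' _ xQ Gxy); rewrite inE yB.
- by rewrite inE negb_or cQ.
- have dQS : [disjoint Q & S].
    rewrite disjoint_subset; apply/subsetP=> x xQ; rewrite inE; apply/negP=> /sB[R RQs xR].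
    by have := dQ R RQs; move/disjointFr/(_ xQ); rewrite xR.
  have := deg_adj uQ Gcu; have := weightU (fun y => G c y) dQS.
  rewrite /weight -!/(deg _ _) => ->; lia.
- move=> x /setUP[xQ|/sB[R RQs xR]]; first by exists Q; rewrite ?mem_head.
  by exists R; rewrite // inE RQs orbT.
Qed.

(** Each of the [n] rounds joins one [P0] and a part [Q] of [B] into a theta, and costs every other
    [P] at most [ladder_loss] edges. Locating the thetas in [B] and the members of [Ps] keeps them
    disjoint through the induction. *)
Lemma ladder_thetas n Ps B : size Ps = n -> conn G B -> disjoint_seq Ps ->
  (forall P, P \in Ps -> [/\ conn G P, [disjoint P & B] &
     n * ladder_loss <= weight (deg P) B]) ->
  exists Xs, [/\ size Xs = n, disjoint_seq Xs & forall X, X \in Xs -> theta G X /\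
     forall x, x \in X -> x \in B \/ exists2 P, P \in Ps & x \in P].
Proof.
elim: n Ps B => [|n IH] Ps B szP cB dPs hPs; first by exists [::].
(* The cut asks for three edges from some member of [Ps]; so no component of [Q :\ c] receives more
   than two edges from any member. *)
pose Phi Q := exists2 P, P \in Ps & 2 < weight (deg P) Q.
have PhiB : Phi B.
  case: Ps szP hPs {dPs} @Phi => //= P Ps _ hPs; exists P; rewrite ?mem_head //.
  have [_ _] := hPs P (mem_head _ _); rewrite /ladder_loss; lia.
have Phi0 : ~ Phi set0 by case=> P _; rewrite weight0.
have [Q [c [sQB cQ cQc cBQ [[P0 P0s PQ] comps]]]] := conn_cut cB PhiB Phi0.
(* [c] receives fewer than [hub_bound] edges. The components that receive edges form a star at [c],
   so there are fewer than [hub_bound] of them, with at most two edges each. *)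
have loss P : P \in Ps -> weight (deg P) Q <= ladder_loss.
  move=> PPs; have [cP dPB _] := hPs P PPs.
  have cNP : c \notin P by rewrite (disjointFl dPB) // (subsetP sQB).
  have h1 : deg P c < hub_bound := hub cP cNP.
  have sf : star_free (deg P) B hub_bound.
    move=> d Qs dB dQs hQs; apply: (star (c := d) cP _ dQs); first by rewrite (disjointFl dPB).
    by move=> R /hQs[].
  have h2 : weight (deg P) Q <= deg P c + hub_bound * 2.
    apply: star_free_weight cQc cQ sQB sf _ => R RC.
    rewrite leqNgt; apply/negP=> h; apply: (comps R RC); by exists P.
  by rewrite /ladder_loss; lia.
case/splitPr: P0s szP dPs hPs loss PQ {Phi PhiB Phi0 comps} => s1 s2 szP dPs hPs loss PQ.
have sub12 P : P \in s1 ++ s2 -> P \in s1 ++ P0 :: s2.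
  by rewrite !mem_cat inE => /orP[->//|->]; rewrite !orbT.
have [||||Xs [szX dX hX]] := IH (s1 ++ s2) (B :\: Q).
- by move: szP; rewrite !size_cat /=; lia.
- exact: cBQ.
- apply: subseq_pairwise dPs; apply: cat_subseq => //; exact: subseq_cons.
- move=> P /sub12 PPs; have [cP dPB wP] := hPs P PPs; split=> //.
    exact: disjointWr (subsetDl _ _) dPB.
  have := loss P PPs; move: wP; rewrite (weightD _ sQB) mulSn; lia.
have [cP0 dP0B wP0] : [/\ conn G P0, [disjoint P0 & B] & n.+1 * ladder_loss <= weight (deg P0) B].
  by apply: hPs; rewrite mem_cat mem_head orbT.
have dP0 P : P \in s1 ++ s2 -> [disjoint P0 & P].
  move: dPs; rewrite pairwise_cat /= => /and3P[/allrelP d1 _ /andP[/allP d2 _]].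
  rewrite mem_cat => /orP[Ps1|/d2//]; rewrite disjoint_sym; apply: d1 => //; exact: mem_head.
exists (P0 :|: Q :: Xs); split=> /=; first by rewrite szX.
  rewrite dX andbT; apply/allP=> X /hX[_ hX'].
  rewrite disjoint_subset; apply/subsetP=> x xPQ; rewrite inE; apply/negP=> /hX'.
  case/setUP: xPQ => [xP|xQ].
    case=> [/setDP[xB _]|[P Ps12 xP']]; first by rewrite (disjointFr dP0B) in xB.
    by rewrite (disjointFr (dP0 P Ps12)) in xP'.
  case=> [/setDP[_]|[P /sub12 PPs xP']]; first by rewrite xQ.
  have [_ dPB _] := hPs P PPs; have := subsetP sQB x xQ.
  by rewrite (disjointFr dPB).
move=> X; rewrite inE => /predU1P[->|/hX[tX hX']]; last first.
  split=> // x /hX'[/setDP[xB _]|[P /sub12 PPs xP]]; first by left.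
  by right; exists P.
split; last first.
  move=> x /setUP[xP|xQ]; [right; exists P0 => // | by left; apply: (subsetP sQB)].
  by rewrite mem_cat mem_head orbT.
apply: edges_between_theta => //; first exact: disjointWr sQB dP0B.
by rewrite edges_betweenC.
Qed.

(** Otherwise [A] splits into [N] connected pieces with at least [N * ladder_loss] edges to [B]
    each, and these yield [N] disjoint thetas. *)
Lemma ladder A B : conn G A -> conn G B -> [disjoint A & B] ->
  edges_between A B < ladder_bound.
Proof.
move=> cA cB dAB; rewrite ltnNge; apply/negP=> big.
have NC : 0 < N * ladder_loss by rewrite muln_gt0 N_gt0 /ladder_loss addn_gt0 orbT.
have F0 : 0 < hub_bound by rewrite muln_gt0 N_gt0.
have [||Ps [szP dPs hPs]] := split_weight NC F0 cA _ _ big.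
- move=> x xA; apply: ltnW; apply: hub => //; by rewrite (disjointFr dAB).
- move=> c Qs cA' dQs hQs; apply: (star (c := c) cB _ dQs); first by rewrite (disjointFr dAB).
  by move=> R /hQs[].
have [|Xs [szX dX hX]] := ladder_thetas szP cB dPs.
  move=> P /hPs[sPA cP wP]; split=> //; first exact: disjointWl sPA dAB.
  by rewrite -/(edges_between _ _) edges_betweenC.
case: Xs szX dX hX => [|X Xs] szX dX hX; first by move: N_gt0; rewrite -szX.
(* [few_thetas] asks for a vertex; any [a] will do, since adding it to the sets only enlarges
   them. *)
have [[a [_ [_ [_ [_ _]]]]] _] := hX X (mem_head _ _).
have := thetasN (v := a) dX; rewrite szX ltnn => h.
suff: false by []. apply: h => Y /hX[tY _]; exact: theta_mono (subsetUr _ _) tY.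
Qed.

End Bounds.
End Packing.

(** * Colourings with theta-free classes *)

Section Colouring.
Variables (V : finType) (G : graph V).
Variables (N K : nat).
Hypotheses (N_gt0 : 0 < N) (thetasN : few_thetas G N) (linksK : few_links G K).
Implicit Types (A B P Q S T U X Y : {set V}) (x y z c v : V) (col : V -> nat).

(** Ordered pairs are counted, so every two-coloured edge counts twice. *)
Definition bichromatic col A :=
  \sum_(x in A) \sum_(y in A) (G x y && (col x != col y) : nat).

Definition theta_free_colouring col A := forall i, ~ theta G [set x in A | col x == i].

(** A boolean copy of a classical property, for use in colourings and in [count]. *)
Lemma finset_decide (p : {set V} -> Prop) : exists b : pred {set V}, forall X, b X <-> p X.
Proof.
suff /fin_all_exists[b hb] : forall X, exists b : bool, b <-> p X by exists b.
by move=> X; have [pX|pX] := classic (p X); [exists true | exists false].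
Qed.

(** Each component of [P :\ c] that forms a theta with [c] gets its own colour; all else shares
    colour 0 with [c]. Such components form a fan at [c], so they are fewer than [N], and by [hub]
    each has fewer than [hub_bound] edges to [c]. The factor 2 is due to ordered pairs. *)
Lemma colouring_piece P c : c \in P ->
  (forall Q, Q \in components G (P :\ c) -> ~ theta G Q) ->
  exists col, theta_free_colouring col P /\
    bichromatic col P <= 2 * (N * hub_bound N K).
Proof.
move=> cP comps.
have [bad badP] := finset_decide (fun Q => theta G (c |: Q)).
pose cmp := component G (P :\ c).
pose isbad x := (x \in P :\ c) && bad (cmp x).
(* [pickle] numbers the components; the successor reserves 0 for [c] and the harmless components. *)
pose col x := if isbad x then (pickle (cmp x)).+1 else 0.
have cbad : isbad c = false by rewrite /isbad !inE eqxx.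
exists col; split.
  (* A theta of colour 0 would lie in [c] and one component, which would then be bad; a positive
     colour occurs in a single component only, and components are theta-free. *)
  case=> [|i] th.
    have cZ : c \in [set x in P | col x == 0] by rewrite inE cP /col cbad.
    have [Q] := theta_component_del (theta_mono (subsetUr [set c] _) th).
    case/componentsP=> y yZ Qe thQ; subst Q.
    have sub : [set x in P | col x == 0] :\ c \subset P :\ c.
      by apply: setSD; apply/subsetP=> x; rewrite inE => /andP[].
    have sub' : component G ([set x in P | col x == 0] :\ c) y \subset cmp y.
      apply: component_max; first exact: component_conn.
        exact: subset_trans (component_sub _ _ _) sub.
      exact: component_self.
    have /badP by' : theta G (c |: cmp y) := theta_mono (setUS _ sub') thQ.
    have yP := subsetP sub y yZ.
    by case/setD1P: yZ => _; rewrite inE /col /isbad yP by' andbF.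
  have [Z0|[y]] := set_0Vmem [set x in P | col x == i.+1].
    by move: th; rewrite Z0; apply: theta0.
  rewrite inE /col; case: ifP => [/andP[yP _] /andP[_ /eqP[yi]]|_ /andP[]] //.
  apply: (comps (cmp y)); first by apply/componentsP; exists y.
  apply: theta_mono th; apply/subsetP=> x; rewrite inE /col.
  case: ifP => [/andP[xP _] /andP[_ /eqP[xi]]|_ /andP[]] //.
  have -> : cmp y = cmp x by apply: (pcan_inj pickleK); rewrite xi yi.
  exact: component_self.
pose w x : nat := G c x && isbad x.
have wP : weight w P <= N * hub_bound N K.
  have -> : N * hub_bound N K = w c + N * hub_bound N K by rewrite /w cbad andbF.
  apply: (@component_weight_bound _ G _ _ c) => // [Q QC|].
    case/componentsP: (QC) => y yP Qe.
    have cQ : c \notin Q by apply/negP; rewrite Qe => /(subsetP (component_sub _ _ _)); rewrite !inE eqxx.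
    have cnQ : conn G Q by rewrite Qe; apply: component_conn.
    apply: ltnW; apply: leq_ltn_trans (hub thetasN linksK cnQ cQ).
    by apply: leq_sum => x _; rewrite /w; case: (G c x) => //; case: (isbad x).
  set CC := [set _ in _ | _].
  have sCC : CC \subset components G (P :\ c) by apply/subsetP=> Q; rewrite inE => /andP[].
  apply: ltnW; rewrite cardE; apply: (thetasN (v := c)).
    exact: disjoint_seq_components sCC.
  move=> Q; rewrite mem_enum inE => /andP[/componentsP[y yP Qe] /weight_gt0[x xQ]].
  rewrite /w lt0b => /andP[_ /andP[_ /badP]]; rewrite Qe /cmp.
  by move: xQ; rewrite Qe inE => /andP[_ /component_eq->].
apply: leq_trans (leq_mul (leqnn 2) wP).
have colc : col c = 0 by rewrite /col cbad.
have col0 x : (col x != 0) = isbad x by rewrite /col; case: (isbad x).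
(* Adjacent vertices other than [c] lie in the same component, so a two-coloured edge joins [c] to a
   bad component. *)
have pointwise x y : x \in P -> y \in P ->
    (G x y && (col x != col y)) <= (x == c) * w y + (y == c) * w x.
  move=> xP yP; case Gxy: (G x y) => //=.
  have [xc|xc] := eqVneq x c.
    by rewrite xc colc eq_sym col0 /w -xc Gxy mul1n leq_addr.
  have [yc|yc] := eqVneq y c.
    by rewrite yc colc col0 /w -yc (adj_sym _ y x) Gxy mul1n leq_addl.
  have xP' : x \in P :\ c by rewrite !inE xc.
  have yP' : y \in P :\ c by rewrite !inE yc.
  have e : cmp x = cmp y.
    by apply: component_eq; apply: connect1; rewrite /within /= xP' yP'.
  by rewrite /col /isbad xP' yP' e eqxx.
rewrite /bichromatic mul2n -addnn.
apply: (@leq_trans (\sum_(x in P) \sum_(y in P) ((x == c) * w y + (y == c) * w x))).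
  by apply: leq_sum => x xP; apply: leq_sum => y yP; apply: pointwise.
have one : \sum_(x in P) \sum_(y in P) (x == c) * w y = weight w P.
  rewrite (big_setD1 c) //= [X in _ + X]big1 ?addn0.
    by apply: eq_bigr => y _; rewrite eqxx mul1n.
  by move=> x; rewrite !inE => /andP[/negPf-> _]; rewrite big1.
rewrite -{1}one -one [X in _ <= _ + X]exchange_big /= -big_split /=.
by apply: leq_sum => x _; rewrite big_split.
Qed.

(** The cost of one round, in ordered pairs: the edges cut inside the piece [P] and those that leave
    it. *)
Definition edit_loss := 2 * (N * hub_bound N K) + 2 * ladder_bound N K.

(** Induction on the number of disjoint thetas. From a component [S] with a theta, a minimal
    connected [P] with a theta and connected [S :\: P] is cut off. This uses up one theta;
    [colouring_piece] and [ladder] bound the cost. *)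
Lemma colouring n U :
  (forall Xs, disjoint_seq Xs -> (forall X, X \in Xs -> theta G X /\ X \subset U) ->
     size Xs < n) ->
  exists col, theta_free_colouring col U /\ bichromatic col U <= n * edit_loss.
Proof.
elim: n U => [|n IH] U few; first by have : size (Nil {set V}) < 0 by apply: few.
have [thU|nthU] := classic (theta G U); last first.
  exists (fun=> 0); split.
    by move=> i th; apply: nthU; apply: theta_mono th; apply/subsetP=> x; rewrite inE => /andP[].
  by rewrite /bichromatic big1 // => x _; rewrite big1 // => y _; rewrite eqxx andbF.
have [S SC thS] := theta_component thU.
case/componentsP: SC => s sU Se.
have cS : conn G S by rewrite Se; apply: component_conn.
have sSU : S \subset U by rewrite Se; apply: component_sub.
have [P [c [sPS cP cPc cSP [thP comps]]]] := conn_cut cS thS (@theta0 _ _).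
have sPU := subset_trans sPS sSU.
have [col1 [free1 bi1]] := colouring_piece cP comps.
have [Xs dXs hXs|col2 [free2 bi2]] := IH (U :\: P).
  have := few (P :: Xs); rewrite /= ltnS; apply.
    rewrite dXs andbT; apply/allP=> X /hXs[_ sX].
    by rewrite disjoint_sym; apply: disjointWl sX _; rewrite disjoints_subset setDE subsetIr.
  move=> X; rewrite inE => /predU1P[->//|/hXs[tX sX]]; split=> //.
  exact: subset_trans sX (subsetDl _ _).
(* Even colours on [P] and odd ones elsewhere keep the two colourings apart. *)
pose col x := if x \in P then (col1 x).*2 else (col2 x).*2.+1.
exists col; split.
  move=> i th; case odd_i: (odd i).
    apply: (free2 i./2); apply: theta_mono th; apply/subsetP=> x; rewrite !inE /col.
    case: (x \in P) => /andP[xU /eqP xi]; first by move: odd_i; rewrite -xi odd_double.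
    by rewrite xU -xi /= uphalf_double eqxx.
  apply: (free1 i./2); apply: theta_mono th; apply/subsetP=> x; rewrite !inE /col.
  case: (x \in P) => /andP[xU /eqP xi]; last by move: odd_i; rewrite -xi /= odd_double.
  by rewrite -xi doubleK eqxx.
have eqP' x y : x \in P -> y \in P -> (col x != col y) = (col1 x != col1 y).
  by move=> xP yP; rewrite /col xP yP (can_eq doubleK).
have eqD x y : x \in U :\: P -> y \in U :\: P -> (col x != col y) = (col2 x != col2 y).
  move=> /setDP[_ xP] /setDP[_ yP]; rewrite /col (negPf xP) (negPf yP) eqSS.
  by rewrite (can_eq doubleK).
(* As [S] is a component of [U], all edges from [P] to [U :\: P] end in the connected set
   [S :\: P]. *)
have lad : edges_between G P (U :\: P) <= ladder_bound N K.
  apply: ltnW; apply: leq_ltn_trans (ladder N_gt0 thetasN linksK cPc cSP _); last first.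
    by rewrite disjoint_sym disjoints_subset setDE subsetIr.
  apply: leq_sum => x xP; rewrite /deg big_mkcond [leqRHS]big_mkcond /=.
  apply: leq_sum => y _; rewrite !inE; case: (y \in P) => //=.
  case yU: (y \in U) => //; case Gxy: (G x y); last by case: ifP.
  have := subsetP sPS x xP; rewrite Se => xS.
  by rewrite (component_closed xS yU Gxy).
have split_sum (F : V -> nat) : \sum_(x in U) F x = \sum_(x in P) F x + \sum_(x in U :\: P) F x.
  exact: weightD sPU.
have -> : bichromatic col U <= n.+1 * edit_loss =
    (bichromatic col U <= edit_loss + n * edit_loss) by rewrite mulSn.
have b1 : \sum_(x in P) \sum_(y in P) (G x y && (col x != col y) : nat) = bichromatic col1 P.
  by apply: eq_bigr => x xP; apply: eq_bigr => y yP; rewrite eqP'.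
have b2 : \sum_(x in U :\: P) \sum_(y in U :\: P) (G x y && (col x != col y) : nat) =
    bichromatic col2 (U :\: P).
  by apply: eq_bigr => x xP; apply: eq_bigr => y yP; rewrite eqD.
have b3 A B : \sum_(x in A) \sum_(y in B) (G x y && (col x != col y) : nat) <= edges_between G A B.
  by apply: leq_sum => x _; apply: leq_sum => y _; case: (G x y) => //; case: (_ != _).
have b4 := b3 P (U :\: P); have b5 := b3 (U :\: P) P.
rewrite edges_betweenC in b5.
have tot : bichromatic col U =
  (\sum_(x in P) \sum_(y in P) (G x y && (col x != col y) : nat) +
   \sum_(x in P) \sum_(y in U :\: P) (G x y && (col x != col y) : nat)) +
  (\sum_(x in U :\: P) \sum_(y in P) (G x y && (col x != col y) : nat) +
   \sum_(x in U :\: P) \sum_(y in U :\: P) (G x y && (col x != col y) : nat)).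
  rewrite /bichromatic split_sum -!big_split /=.
  by congr (_ + _); apply: eq_bigr => x _; rewrite split_sum.
have el : edit_loss = 2 * (N * hub_bound N K) + 2 * ladder_bound N K by [].
rewrite tot b1 b2; clear -bi1 bi2 b4 b5 lad el; lia.
Qed.

End Colouring.

(** * Topological minors as models *)

(** Multiplicities turn the disjointness of many concatenated lists into linear arithmetic. *)
Lemma uniq_count_leq (T : eqType) (s L : seq T) :
  (forall x, count_mem x s <= count_mem x L) -> uniq L -> uniq s.
Proof.
move=> sL uL; apply: count_mem_uniq => x; have := sL x; rewrite (count_uniq_mem x uL).
have := leq_b1 (x \in L); case: (boolP (x \in s)) => [|/count_memPn->//].
by rewrite -has_pred1 has_count; lia.
Qed.

Section Models.
Variables (W : finType) (H : graph W).

Definition model_path (V : finType) (phi : W -> V) (I : W -> W -> seq V) u v :=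
  phi u :: rcons (I u v) (phi v).

(** [subdivision] without its last demand: the host may have further vertices and edges, so models
    can be moved without forming subgraphs. *)
Definition model (V : finType) (G : graph V) (phi : W -> V) (I : W -> W -> seq V) :=
  [/\ injective phi,
      forall u v, H u v -> [/\ path G (phi u) (rcons (I u v) (phi v)),
         uniq (model_path phi I u v) & I v u = rev (I u v)],
      forall u v w, H u v -> phi w \notin I u v &
      forall u v u' v', H u v -> H u' v' -> [set u; v] != [set u'; v'] ->
        forall x, ~~ ((x \in I u v) && (x \in I u' v'))].

Definition supported (V : finType) (phi : W -> V) (I : W -> W -> seq V) (X : {set V}) :=
  (forall w, phi w \in X) /\ (forall u v, H u v -> {subset I u v <= X}).

Lemma supported_path (V : finType) (phi : W -> V) I (X : {set V}) u v :
  supported phi I X -> H u v -> {subset model_path phi I u v <= X}.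
Proof.
move=> [sp sI] Huv x; rewrite inE mem_rcons inE => /or3P[/eqP->|/eqP->|/(sI _ _ Huv)] //;
  exact: sp.
Qed.

(** [g] is constrained only on the support and may be arbitrary elsewhere, as [insubd] is outside
    its subtype. *)
Lemma model_map (V V' : finType) (G : graph V) (G' : graph V') phi I (X : {set V}) (g : V -> V') :
  model G phi I -> supported phi I X -> {in X &, injective g} ->
  {in X &, forall x y, G x y -> G' (g x) (g y)} ->
  model G' (g \o phi) (fun u v => map g (I u v)).
Proof.
move=> [inj hI hphi hdis] sup ginj ghom; have [sp sI] := sup.
have mapI x u v : x \in X -> H u v -> (g x \in map g (I u v)) = (x \in I u v).
  move=> xX Huv; apply/mapP/idP => [[y yI e]|xI]; last by exists x.
  by rewrite (ginj x y xX (sI _ _ Huv y yI) e).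
split.
- by move=> u v /= e; apply: inj; apply: ginj e.
- move=> u v Huv; have [pI uI rI] := hI u v Huv; split; last by rewrite rI map_rev.
    rewrite /= -map_rcons; apply: (homo_path_in (P := mem X)) pI; first exact: ghom.
    by apply/allP=> x; apply: (supported_path sup Huv).
  have -> : model_path (g \o phi) (fun u v => map g (I u v)) u v = map g (model_path phi I u v).
    by rewrite /model_path /= map_rcons.
  rewrite map_inj_in_uniq // => x y xP yP.
  by apply: ginj; apply: (supported_path sup Huv).
- by move=> u v w Huv; rewrite /= mapI // hphi.
- move=> u v u' v' Huv Huv' ne x; apply/negP=> /andP[/mapP[y yI ->]].
  rewrite mapI // => [yI'|]; last exact: sI yI.
  by have := hdis _ _ _ _ Huv Huv' ne y; rewrite yI yI'.
Qed.

Lemma supportedT (V : finType) (phi : W -> V) I : supported phi I [set: V].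
Proof. by split=> // u v _ x _; rewrite inE. Qed.

Lemma supported_map (V V' : finType) phi I (X : {set V}) (Y : {set V'}) (g : V -> V') :
  supported phi I X -> (forall x, x \in X -> g x \in Y) ->
  supported (g \o phi) (fun u v => map g (I u v)) Y.
Proof.
move=> [sp sI] gXY; split=> [w|u v Huv x /mapP[y yI ->]]; first exact/gXY/sp.
by apply: gXY; apply: sI yI.
Qed.

Lemma minor_model (V : finType) (G : graph V) :
  topological_minor H G -> exists phi I, model G phi I.
Proof.
case=> K [phi [I [inj hI hphi hdis _]]].
have mK : model (sub_graph K) phi I by split.
exists (val \o phi), (fun u v => map val (I u v)).
apply: model_map mK (supportedT _ _) _ _; first by move=> x y _ _; apply: val_inj.
by move=> x y _ _; apply: sub_adj.
Qed.

Lemma path_infix (T : eqType) (e : rel T) x s :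
  (forall y z, infix [:: y; z] (x :: s) -> e y z) -> path e x s.
Proof.
elim: s x => //= y s IH x h; apply/andP; split.
  by apply: h; apply: (prefix_infix [:: x; y]).
by apply: IH => z t zt; apply: h; apply/orP; right.
Qed.

(** * The subgraph traced out by a model *)

Section UsedGraph.
Variables (V : finType) (G : graph V) (phi : W -> V) (I : W -> W -> seq V).
Hypothesis mI : model G phi I.

(** Only edges traversed by the paths are kept, as [subdivision] admits no others. *)
Let used_adj : rel V := fun x y =>
  [exists u, [exists v, H u v && infix [:: x; y] (model_path phi I u v)]].

Let used_adjP x y : reflect
  (exists u v, H u v /\ infix [:: x; y] (model_path phi I u v)) (used_adj x y).
Proof.
apply: (iffP existsP) => [[u /existsP[v /andP[]]]|[u [v []]]]; first by exists u, v.
by move=> Huv inf; exists u; apply/existsP; exists v; rewrite Huv.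
Qed.

Fact used_sym : symmetric used_adj.
Proof.
suff half x y : used_adj x y -> used_adj y x by move=> x y; apply/idP/idP; apply: half.
case/used_adjP=> u [v [Huv inf]]; apply/used_adjP; exists v, u; rewrite adj_sym; split=> //.
have [_ hI _ _] := mI; have [_ _ rI] := hI u v Huv.
have -> : model_path phi I v u = rev (model_path phi I u v).
  by rewrite /model_path rI rev_cons rev_rcons.
by rewrite -[[:: y; x]]/(rev [:: x; y]) infix_rev.
Qed.

Fact used_irr : irreflexive used_adj.
Proof.
move=> x; apply/negbTE/negP=> /used_adjP[u [v [Huv inf]]].
have [_ hI _ _] := mI; have [_ uI _] := hI u v Huv.
by have := infix_uniq inf uI; rewrite /= inE eqxx.
Qed.

Definition used_graph : graph V := Graph used_sym used_irr.

Lemma used_graph_sub x y : used_graph x y -> G x y.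
Proof.
case/used_adjP=> u [v [Huv inf]].
have [_ hI _ _] := mI; have [pI _ _] := hI u v Huv.
have : sorted G (model_path phi I u v) by [].
by move/(infix_sorted inf) => /=; rewrite andbT.
Qed.

Definition used_verts : {set V} :=
  [set x | [exists w, x == phi w] || [exists u, [exists v, H u v && (x \in I u v)]]].

Lemma used_vertsP x : x \in used_verts ->
  (exists w, x = phi w) \/ (exists u v, H u v /\ x \in I u v).
Proof.
rewrite inE => /orP[/existsP[w /eqP]|/existsP[u /existsP[v /andP[]]]]; [left|right].
  by exists w.
by exists u, v.
Qed.

Lemma used_supported : supported phi I used_verts.
Proof.
split=> [w|u v Huv x xI]; rewrite inE; first by apply/orP; left; apply/existsP; exists w.
by apply/orP; right; apply/existsP; exists u; apply/existsP; exists v; rewrite Huv.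
Qed.

Lemma used_subP x y : induced used_graph used_verts x y -> G (val x) (val y).
Proof. exact: used_graph_sub. Qed.

Definition used_subgraph : subgraph G := Subgraph used_subP.

Lemma model_minor (w0 : W) : topological_minor H G.
Proof.
exists used_subgraph.
have [sp sI] := used_supported.
(* The model is moved into the subtype of used vertices; [phi w0] is the default value outside. *)
pose g : V -> vset used_verts := insubd (Sub (phi w0) (sp w0) : vset used_verts).
have gK : {in used_verts, cancel g val} by move=> x; apply: insubdK.
have mu : model used_graph phi I.
  have [inj hI hphi hdis] := mI; split=> // u v Huv; have [pI uI rI] := hI u v Huv.
  by split=> //; apply: path_infix => y z inf; apply/used_adjP; exists u, v.
have [] := @model_map _ _ used_graph (induced used_graph used_verts) _ _ _ g mu used_supported.
- by move=> x y xX yX e; rewrite -(gK x xX) -(gK y yX) e.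
- by move=> x y xX yX Gxy; rewrite /= !gK.
move=> inj hI hphi hdis; exists (g \o phi), (fun u v => map g (I u v)); split=> //.
split.
  move=> x; have [[w xw]|[u [v [Huv xI]]]] := used_vertsP (valP x); [left|right].
    by exists w; apply: val_inj; rewrite /= gK.
  by exists u, v; split=> //; rewrite -(valKd (Sub (phi w0) (sp w0) : vset used_verts) x) map_f.
move=> x y /used_adjP[u [v [Huv inf]]]; exists u, v; split=> //.
have -> : [:: x; y] = map g [:: val x; val y] by rewrite /= /g !valKd.
case/infixP: inf => s1 [s2 e]; apply/infixP; exists (map g s1), (map g s2).
by rewrite -!map_cat -e /model_path /= map_rcons.
Qed.

End UsedGraph.

(** One path per edge, from the end of lower rank, is enough: the other direction is its reversal,
    and disjointness is checked on oriented edges only. *)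
Lemma model_oriented (V : finType) (G : graph V) (phi : W -> V) (J : W -> W -> seq V)
    (rk : W -> nat) : injective rk -> injective phi ->
  (forall u v, H u v -> rk u < rk v -> [/\ path G (phi u) (rcons (J u v) (phi v)),
     uniq (model_path phi J u v) & forall w, phi w \notin J u v]) ->
  (forall u v u' v', H u v -> rk u < rk v -> H u' v' -> rk u' < rk v' ->
     (u, v) != (u', v') -> forall x, x \in J u v -> x \in J u' v' -> False) ->
  let I u v := if rk u < rk v then J u v else rev (J v u) in
  model G phi I.
Proof.
move=> rkI inj hJ hdis I.
have orient u v : H u v -> rk u < rk v \/ (rk v < rk u).
  case: (ltngtP (rk u) (rk v)) => [? _|? _|/rkI->]; [by left|by right|by rewrite adj_irr].
have memI u v : H u v -> exists a b, [/\ H a b, rk a < rk b, [set u; v] = [set a; b] &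
    I u v =i J a b].
  move=> Huv; case: (orient u v Huv) => lt; first by exists u, v; rewrite /I lt.
  exists v, u; rewrite adj_sym setUC lt /I [rk u < rk v]ltnNge (ltnW lt); split=> // x.
  by rewrite mem_rev.
split=> //.
- move=> u v Huv; case: (orient u v Huv) => lt.
    have [pJ uJ _] := hJ u v Huv lt; rewrite /model_path /I lt.
    by rewrite ltnNge (ltnW lt).
  have Hvu : H v u by rewrite adj_sym.
  have [pJ uJ _] := hJ v u Hvu lt.
  have nlt : (rk u < rk v) = false by rewrite ltnNge (ltnW lt).
  rewrite /model_path /I lt nlt revK; split=> //.
    have := rev_path G (phi v) (rcons (J v u) (phi u)); rewrite last_rcons belast_rcons rev_cons => ->.
    by rewrite (eq_path (e' := G)) // => x y; rewrite adj_sym.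
  rewrite -rev_uniq rev_cons rev_rcons revK; exact: uJ.
- move=> u v w /memI[a [b [Hab lt _ e]]]; rewrite e.
  by have [_ _ ->] := hJ a b Hab lt.
move=> u v u' v' /memI[a [b [Hab lt -> e]]] /memI[a' [b' [Hab' lt' -> e']]] ne x.
rewrite e e'; apply/negP=> /andP[x1 x2]; apply: (hdis a b a' b' Hab lt Hab' lt' _ x x1 x2).
by apply: contraNneq ne => -[-> ->].
Qed.

End Models.

(** Turns minors of an induced subgraph into models in [G] itself, which avoids work in the
    subtype. *)
Lemma minor_induced (W V : finType) (H : graph W) (G : graph V) (w0 : W) (U : {set V}) :
  topological_minor H (induced G U) <-> exists phi I, model H G phi I /\ supported H phi I U.
Proof.
split=> [/minor_model[phi [I mI]]|[phi [I [mI sI]]]].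
  exists (val \o phi), (fun u v => map val (I u v)); split.
    apply: model_map mI (supportedT _ _ _) _ _ => //.
    by move=> x y _ _; apply: val_inj.
  by apply: supported_map (supportedT _ _ _) _ => x _; apply: valP.
have x0 : vset U := Sub (phi w0) (sI.1 w0).
pose g : V -> vset U := insubd x0.
have gK : {in U, cancel g val} by move=> x; apply: insubdK.
apply: model_minor w0; apply: (model_map (g := g)) mI sI _ _.
  by move=> x y xX yX e; rewrite -(gK x xX) -(gK y yX) e.
by move=> x y xX yX Gxy; rewrite /= !gK.
Qed.

Lemma model_refl (W : finType) (H : graph W) : model H H id (fun _ _ => [::]).
Proof.
split=> // u v Huv; rewrite /model_path /= inE Huv; split=> //.
by rewrite andbT; apply: contraTneq Huv => ->; rewrite adj_irr.
Qed.

Lemma minor_refl (W : finType) (H : graph W) (w0 : W) : topological_minor H H.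
Proof. exact: model_minor (model_refl H) w0. Qed.

(** * The diamond *)

Notation d0 := (@Ordinal 4 0 isT).
Notation d1 := (@Ordinal 4 1 isT).
Notation d2 := (@Ordinal 4 2 isT).
Notation d3 := (@Ordinal 4 3 isT).

(** An arithmetic form for [lia]: the pairs of sum 3 are 03, the missing edge, and 12, the only pair
    of product 2. *)
Lemma diamondE (i j : 'I_4) : diamond i j =
  (val i != val j) && (val i + val j != 3) || (val i * val j == 2).
Proof.
rewrite /= /diamond_adj eqEsubset !subUset !sub1set !inE.
by case: i => [[|[|[|[|i]]]] hi] //; case: j => [[|[|[|[|j]]]] hj].
Qed.

Section DiamondTheta.
Variables (V : finType) (G : graph V).

Lemma uniq_flatten (T : eqType) (ss : seq (seq T)) : all uniq ss ->
  pairwise (fun s t => ~~ has (mem s) t) ss -> uniq (flatten ss).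
Proof.
elim: ss => //= s ss IH /andP[us uss] /andP[/allP ds dss].
rewrite cat_uniq us IH // andbT; apply/hasPn=> x /flattenP[t /ds/hasPn h xt].
exact: h.
Qed.

(** The vertices 1 and 2 of degree three become the ends of the paths 1-0-2, 1-3-2 and 1-2. *)
Lemma model_theta phi I (X : {set V}) :
  model diamond G phi I -> supported diamond phi I X -> theta G X.
Proof.
move=> [inj hI hphi hdis] sup.
have h10 : diamond d1 d0 by rewrite diamondE.
have h02 : diamond d0 d2 by rewrite diamondE.
have h13 : diamond d1 d3 by rewrite diamondE.
have h32 : diamond d3 d2 by rewrite diamondE.
have h12 : diamond d1 d2 by rewrite diamondE.
have un u v : diamond u v -> uniq (I u v).
  by move=> h; have [_ + _] := hI u v h; rewrite /model_path /= rcons_uniq => /and3P[].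
have np u v w : diamond u v -> phi w \in I u v = false by move=> h; apply/negbTE/hphi.
(* Edges whose labels differ in sum or product are distinct, so disjointness is settled by
   computation. *)
have nI u v u' v' : diamond u v -> diamond u' v' ->
    (val u + val v != val u' + val v') || (val u * val v != val u' * val v') -> ~~ has (mem (I u v)) (I u' v').
  move=> h h' ne; apply/hasPn=> x x'; apply/negP=> /= x1.
  have := hdis _ _ _ _ h h' _ x; rewrite x1 x' /= => hh.
  suff: false by []; apply: hh; apply: contraTneq ne => /setP e.
  have := e u; have := e v; have := e u'; have := e v'; rewrite !inE !eqxx ?orbT /=.
  rewrite -!val_eqE /= => e1 e2 e3 e4.
  by move: (h) (h'); rewrite !diamondE; clear -e1 e2 e3 e4; lia.
have up : uniq [:: phi d1; phi d2; phi d0; phi d3].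
  by rewrite (map_inj_uniq inj [:: d1; d2; d0; d3]).
have nhas u v : diamond u v -> ~~ has (mem [:: phi d1; phi d2; phi d0; phi d3]) (I u v).
  move=> h; apply/hasPn=> x xI; apply/negP; rewrite /= !inE => hx.
  by move: hx xI => /or4P[] /eqP->; rewrite np.
have [p10 _ _] := hI _ _ h10; have [p02 _ _] := hI _ _ h02.
have [p13 _ _] := hI _ _ h13; have [p32 _ _] := hI _ _ h32.
have [p12 _ _] := hI _ _ h12.
have glue p q x y z : path G x (rcons p y) -> path G y (rcons q z) ->
    path G x (rcons (p ++ y :: q) z).
  by move=> hp hq; rewrite rcons_cat rcons_cons -cat_rcons cat_path hp last_rcons.
exists (phi d1), (phi d2), (I d1 d0 ++ phi d0 :: I d0 d2), (I d1 d3 ++ phi d3 :: I d3 d2), (I d1 d2).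
have pe : perm_eq [:: phi d1, phi d2 & (I d1 d0 ++ phi d0 :: I d0 d2) ++
      (I d1 d3 ++ phi d3 :: I d3 d2) ++ I d1 d2]
    (flatten [:: [:: phi d1; phi d2; phi d0; phi d3]; I d1 d0; I d0 d2; I d1 d3; I d3 d2; I d1 d2]).
  by apply/permP=> f; rewrite /= !(count_cat, cats0) /= ?count_cat /=; clear; lia.
split; last 3 first.
- by case: (I _ _).
- by case: (I _ _).
- move=> x; rewrite (perm_mem pe) /= !inE !mem_cat; have [sp sI] := sup.
  rewrite orbF; case/or4P => [/eqP->|/eqP->|/eqP->|]; try exact: sp.
  case/or4P => [/eqP->|||]; [exact: sp | exact: sI | exact: sI |].
  by case/or3P => /(sI _ _ _); apply.
split; try by [apply: glue | ].
rewrite (perm_uniq pe); apply: uniq_flatten.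
  by rewrite /all !un // up.
by rewrite /pairwise /all !nhas // !nI.
Qed.

(** [a] and [b] play 1 and 2, while 0 and 3 go to chosen internal vertices [z1] and [z2] of two
    paths; this freedom lets a given vertex be placed at 0. *)
Lemma diamond_model a b z1 z2 s1 t1 s2 t2 p3 :
  three_paths G a b (s1 ++ z1 :: t1) (s2 ++ z2 :: t2) p3 ->
  exists phi I, [/\ model diamond G phi I, phi d0 = z1, phi d1 = a &
    supported diamond phi I [set x in [:: a, b & (s1 ++ z1 :: t1) ++ (s2 ++ z2 :: t2) ++ p3]]].
Proof.
case=> pth1 pth2 pth3 un; set L := [:: a, b & _] in un *.
pose phi (i : 'I_4) := nth z1 [:: z1; a; b; z2] i.
pose J (u v : 'I_4) := match val u, val v with
  | 0, 1 => rev s1 | 0, 2 => t1 | 1, 2 => p3 | 1, 3 => s2 | 2, 3 => rev t2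
  | _, _ => [::] end.
(* No vertex occurs twice in [L]; injectivity and disjointness below are read off from these
   multiplicities. *)
have cntL x : count_mem x L = (a == x) + (b == x) + (z1 == x) + (z2 == x) +
    count_mem x s1 + count_mem x t1 + count_mem x s2 + count_mem x t2 + count_mem x p3.
  by rewrite /L /= !count_cat /= ; clear; lia.
have cntL1 x : count_mem x L <= 1 by rewrite (count_uniq_mem x un) leq_b1.
have revp p x y : path G x (rcons p y) -> path G y (rcons (rev p) x).
  move=> h; have := rev_path G x (rcons p y); rewrite last_rcons belast_rcons rev_cons => ->.
  by rewrite (eq_path (e' := G)) // => u v; rewrite adj_sym.
have unsplit s z t x y : path G x (rcons (s ++ z :: t) y) ->
    path G x (rcons s z) /\ path G z (rcons t y).
  by rewrite rcons_cat rcons_cons -cat_rcons cat_path last_rcons => /andP[].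
have [q1 q2] := unsplit _ _ _ _ _ pth1; have [q3 q4] := unsplit _ _ _ _ _ pth2.
have phi_inj : injective phi.
  have : uniq [:: z1; a; b; z2].
    by apply: uniq_count_leq un => x; rewrite cntL /=; clear; lia.
  move=> up i j /eqP; rewrite /phi nth_uniq ?(ltn_ord i) ?(ltn_ord j) //.
  by move/eqP/val_inj.
have cJ x u v : count_mem x (J u v) <= count_mem x s1 + count_mem x t1 + count_mem x s2 +
    count_mem x t2 + count_mem x p3.
  rewrite /J; case: (val u) => [|[|[|?]]]; case: (val v) => [|[|[|[|?]]]] //=;
    rewrite ?count_rev; clear; lia.
have mI := @model_oriented _ diamond _ G phi J val val_inj phi_inj.
exists phi; eexists; split; first apply: mI.
- move=> u v + lt; rewrite diamondE => h; split.
  + move: u v lt h => [[|[|[|[|u]]]] hu] [[|[|[|[|v]]]] hv] //= _ _; rewrite /J /phi /=; by [apply: revp|].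
  + rewrite /model_path; apply: uniq_count_leq un => x; rewrite cntL.
    move: u v lt h => [[|[|[|[|u]]]] hu] [[|[|[|[|v]]]] hv] //= _ _;
      rewrite /J /phi /= -cats1 count_cat /= ?count_rev; clear; lia.
  + move=> w; apply/negP; rewrite -has_pred1 has_count => pos.
    have := cJ (phi w) u v; have := cntL1 (phi w); rewrite cntL => c1 c2.
    move: w pos c1 c2 => [[|[|[|[|w]]]] hw] //=; rewrite /phi /= eqxx; clear; lia.
- move=> u v u' v'; rewrite !diamondE => h lt h' lt' ne x.
  rewrite -!has_pred1 !has_count => x1 x2; have := cntL1 x; rewrite cntL.
  move: u v u' v' h lt h' lt' ne x1 x2 => [[|[|[|[|u]]]] hu] [[|[|[|[|v]]]] hv] //
    [[|[|[|[|u']]]] hu'] [[|[|[|[|v']]]] hv'] //= _ _ _ _ ne;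
    rewrite /J /= ?count_rev; try (clear; lia); by case/eqP: ne; congr pair; apply: val_inj.
- by [].
- by [].
have sJ u v : {subset J u v <= [set x in L]}.
  move=> x; rewrite inE -!has_pred1 !has_count => x1.
  have := cJ x u v; rewrite cntL; move: x1; clear; lia.
split=> [w|u v _].
  rewrite inE -has_pred1 has_count cntL.
  move: w => [[|[|[|[|w]]]] hw] //=; rewrite /phi /= eqxx; clear; lia.
by case: ifP => _ x; rewrite ?mem_rev; apply: sJ.
Qed.

(** If [v] is on the theta, it is internal to a path and becomes the vertex 0 of degree two, or it
    is an end and becomes the vertex 1 of degree three. The three cases lead to three kinds of
    fan. *)
Lemma theta_model v X : theta G (v |: X) ->
  [\/ exists phi I, model diamond G phi I /\ supported diamond phi I X,
      exists phi I, [/\ model diamond G phi I, supported diamond phi I (v |: X) & phi d0 = v] |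
      exists phi I, [/\ model diamond G phi I, supported diamond phi I (v |: X) & phi d1 = v]].
Proof.
have sup_mono phi I (A B : {set V}) : A \subset B -> supported diamond phi I A -> supported diamond phi I B.
  move=> /subsetP sAB [sp sI]; split=> [w|u w h x /(sI _ _ h)/sAB//]; exact/sAB/sp.
case=> a [b [p1 [p2 [p3 [h n1 n2 sub]]]]].
have splitp p : p != [::] -> exists s z t, p = s ++ z :: t :> seq V.
  by case: p => // z t _; exists [::], z, t.
have perm q1 q2 q3 : perm_eq [:: p1; p2; p3] [:: q1; q2; q3] ->
    [set x in [:: a, b & p1 ++ p2 ++ p3]] = [set x in [:: a, b & q1 ++ q2 ++ q3]].
  move=> pq; apply/setP=> x; rewrite !inE.
  by have := perm_mem (perm_flatten pq) x; rewrite /= !cats0 => ->.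
have Lsub : [set x in [:: a, b & p1 ++ p2 ++ p3]] \subset v |: X.
  by apply/subsetP=> x; rewrite inE => /sub.
have [s1 [z1 [t1 e1]]] := splitp _ n1; have [s2 [z2 [t2 e2]]] := splitp _ n2.
have [vL|vL] := boolP (v \in [:: a, b & p1 ++ p2 ++ p3]); last first.
  constructor 1; have := h; rewrite e1 e2 => h'.
  have [phi [I [mI _ _ sI]]] := diamond_model h'; exists phi, I; split=> //.
  apply: sup_mono sI; rewrite -e1 -e2; apply/subsetP=> x; rewrite inE => xL.
  by have := sub x xL; case/setU1P=> // xv; rewrite -xv xL in vL.
have onfirst q1 q2 q3 : perm_eq [:: p1; p2; p3] [:: q1; q2; q3] -> q2 != [::] -> v \in q1 ->
    exists phi I, [/\ model diamond G phi I, supported diamond phi I (v |: X) & phi d0 = v].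
  move=> pq m2 vq; have h' := three_paths_perm pq h.
  have := perm _ _ _ pq; case/splitPr: vq h' {pq} => s t h' eL.
  have [s' [z [t' e']]] := splitp _ m2; rewrite e' in h' eL.
  have [phi [I [mI p0 _ sI]]] := diamond_model h'; exists phi, I; split=> //.
  by apply: sup_mono Lsub _; rewrite eL.
move: vL; rewrite !inE !mem_cat => /or4P[/eqP va|/eqP vb|v1|/orP[v2|v3]].
- constructor 3; have := h; rewrite e1 e2 => h'.
  have [phi [I [mI _ p1' sI]]] := diamond_model h'; exists phi, I; split=> //; last by rewrite p1'.
  by apply: sup_mono Lsub _; rewrite e1 e2.
- constructor 3; have := three_paths_sym h; rewrite e1 e2 !rev_cat !rev_cons !cat_rcons => h'.
  have [phi [I [mI _ p1' sI]]] := diamond_model h'; exists phi, I; split=> //; last by rewrite p1'.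
  apply: sup_mono sI; apply: subset_trans Lsub; apply/subsetP=> x; rewrite e1 e2 !inE !mem_cat !inE !mem_rev.
  by clear; lia.
- by constructor 2; apply: (onfirst p1 p2 p3).
- constructor 2; apply: (onfirst p2 p1 p3) => //.
  by apply/permP=> f /=; clear; lia.
- constructor 2; apply: (onfirst p3 p1 p2) => //.
  by apply/permP=> f /=; clear; lia.
Qed.

Lemma theta_minor X : theta G X <-> topological_minor diamond (induced G X).
Proof.
rewrite (minor_induced _ _ d0); split; last by case=> phi [I [mI /(model_theta mI)]].
case=> a [b [p1 [p2 [p3 [h n1 n2 sub]]]]].
case: p1 h n1 sub => // z1 t1 h _; case: p2 h n2 => // z2 t2 h _ sub.
have [phi [I [mI _ _ [sp sI]]]] := @diamond_model a b z1 z2 [::] t1 [::] t2 p3 h.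
exists phi, I; split=> //; split=> [w|u w huw x /(sI _ _ huw)]; last by rewrite inE => /sub.
by have := sp w; rewrite inE => /sub.
Qed.

Lemma diamond_freeE : diamond_free G <-> ~ theta G [set: V].
Proof.
rewrite /diamond_free theta_minor (minor_induced _ _ d0); split=> nth.
  by case=> phi [I [mI _]]; apply: nth; apply: model_minor mI d0.
case/minor_model=> phi [I mI]; apply: nth; exists phi, I; split=> //.
exact: supportedT.
Qed.

End DiamondTheta.

(** * Fans *)

Section FanModel.
Variables (W : finType) (H : graph W) (S : {set W}) (k : nat).

Definition fan_proj (x : fan_vertex S k) : W :=
  match x with inl u => val u | inr (_, u) => val u end.

Definition in_copy (i : 'I_k) (x : fan_vertex S k) : bool :=
  match x with inl _ => true | inr (j, _) => j == i end.

Lemma fan_proj_inj i x y : in_copy i x -> in_copy i y -> fan_proj x = fan_proj y -> x = y.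
Proof.
case: x => [u|[j u]]; case: y => [v|[l v]] /=.
- by move=> _ _ /val_inj->.
- by move=> _ _ e; have := valP v; rewrite inE => /negP[]; rewrite -[val v]e (valP u).
- by move=> _ _ e; have := valP u; rewrite inE => /negP[]; rewrite [val u]e (valP v).
- by move=> /eqP-> /eqP-> /val_inj->.
Qed.

Lemma fan_proj_inS x : (fan_proj x \in S) = if x is inl _ then true else false.
Proof. by case: x => [u|[j u]] /=; have := valP u; rewrite ?inE => // /negPf. Qed.

Lemma in_copy2 i j x : i != j -> in_copy i x -> in_copy j x -> fan_proj x \in S.
Proof. by rewrite fan_proj_inS; case: x => [//|[l u]] /= ne /eqP e; rewrite e (negPf ne). Qed.

Lemma fan_lift i w : exists x, in_copy i x /\ fan_proj x = w.
Proof.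
have [wS|wS] := boolP (w \in S); first by exists (inl (Sub w wS)).
have wS' : w \in ~: S by rewrite inE.
by exists (inr (i, Sub w wS')); rewrite /= eqxx.
Qed.

(** The copy that draws the edge [xy], or the vertex [x] if [y = x]; [i0] draws what lies inside
    [S]. *)
Definition fan_index (i0 : 'I_k) (x y : fan_vertex S k) : 'I_k :=
  match x, y with
  | inr (i, _), _ => i
  | inl _, inr (j, _) => j
  | inl _, inl _ => i0
  end.

Lemma fan_index_copy i0 x : in_copy (fan_index i0 x x) x.
Proof. by case: x => [//|[i u]] /=. Qed.

Lemma fan_edge i0 x y : fan H S k x y ->
  [/\ H (fan_proj x) (fan_proj y), in_copy (fan_index i0 x y) x,
      in_copy (fan_index i0 x y) y & fan_index i0 y x = fan_index i0 x y].
Proof.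
by case: x => [u|[i u]]; case: y => [v|[j v]] //=; case/andP=> /eqP-> ->; rewrite eqxx.
Qed.

(** Every vertex and edge of the fan is drawn by the model of its copy. Two copies overlap only in
    images of [S], where the models agree, and such branch vertices are internal to no path. *)
Lemma fan_model (V : finType) (G : graph V) (i0 : 'I_k) (phi : 'I_k -> W -> V)
    (I : 'I_k -> W -> W -> seq V) (Y : 'I_k -> {set V}) :
  (forall i, model H G (phi i) (I i)) -> (forall i, supported H (phi i) (I i) (Y i)) ->
  (forall i j w, w \in S -> phi i w = phi j w) ->
  (forall i j x, i != j -> x \in Y i -> x \in Y j -> exists2 w, w \in S & x = phi i w) ->
  exists Phi II, model (fan H S k) G Phi II.
Proof.
move=> mI sI agree overlap.
pose Phi (x : fan_vertex S k) := phi (fan_index i0 x x) (fan_proj x).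
pose II (x y : fan_vertex S k) := I (fan_index i0 x y) (fan_proj x) (fan_proj y).
have PhiE i x : in_copy i x -> Phi x = phi i (fan_proj x).
  rewrite /Phi => ix; have [->//|ne] := eqVneq (fan_index i0 x x) i.
  exact/agree/(in_copy2 ne _ ix)/fan_index_copy.
exists Phi, II; split.
- move=> x y; rewrite /Phi => e.
  set i := fan_index i0 x x in e *; set j := fan_index i0 y y in e *.
  have ix : in_copy i x := fan_index_copy i0 x.
  have jy : in_copy j y := fan_index_copy i0 y.
  have [ij|ij] := eqVneq i j.
    rewrite -ij in e jy; have [inj _ _ _] := mI i.
    exact: fan_proj_inj ix jy (inj _ _ e).
  have xY : phi i (fan_proj x) \in Y i by have [sp _] := sI i.
  have xY' : phi i (fan_proj x) \in Y j by rewrite e; have [sp _] := sI j.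
  have [w wS e1] := overlap i j _ ij xY xY'.
  have [inj _ _ _] := mI i; have [inj' _ _ _] := mI j.
  have xw := inj _ _ e1; have yw : fan_proj y = w by apply: inj'; rewrite -e e1; apply: agree.
  have iy : in_copy i y by move: wS; rewrite -yw fan_proj_inS; case: (y).
  by apply: fan_proj_inj ix iy _; rewrite xw yw.
- move=> x y /(fan_edge i0)[Hxy ix iy e].
  rewrite /model_path /II e (PhiE _ _ ix) (PhiE _ _ iy).
  by have [_ hI _ _] := mI (fan_index i0 x y); apply: hI.
- move=> x y z /(fan_edge i0)[Hxy ix iy e]; rewrite /II.
  set i := fan_index i0 x y in ix iy *.
  have [_ _ hphi _] := mI i.
  have [iz|iz] := boolP (in_copy i z); first by rewrite (PhiE _ _ iz) hphi.
  set j := fan_index i0 z z; have jz : in_copy j z := fan_index_copy i0 z.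
  rewrite (PhiE _ _ jz); apply/negP=> zI.
  have ij : i != j by apply: contraNneq iz => ->.
  have [_ sIi] := sI i; have [spj _] := sI j.
  have [w wS e1] := overlap i j _ ij (sIi _ _ Hxy _ zI) (spj _).
  by have := hphi _ _ w Hxy; rewrite -e1 zI.
move=> x y x' y' /(fan_edge i0)[Hxy ix iy _] /(fan_edge i0)[Hxy' ix' iy' _] ne z; rewrite /II.
set i := fan_index i0 x y in ix iy *; set j := fan_index i0 x' y' in ix' iy' *.
have [_ _ hphi hdis] := mI i.
have [ij|ij] := eqVneq i j.
  rewrite -ij in ix' iy' *; apply: hdis => //; apply: contraNneq ne => e.
  have mem a b t : in_copy i a -> in_copy i b ->
      (t \in [set a; b]) = in_copy i t && (fan_proj t \in [set fan_proj a; fan_proj b]).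
    move=> ia ib; rewrite !inE; apply/idP/idP => [/orP[]/eqP->|].
    - by rewrite ia eqxx.
    - by rewrite ib eqxx orbT.
    - case/andP=> it /orP[] /eqP; first by move/(fan_proj_inj it ia)->; rewrite eqxx.
      by move/(fan_proj_inj it ib)->; rewrite eqxx orbT.
  by apply/eqP/setP=> t; rewrite !mem // e.
apply/negP=> /andP[zI zI'].
have [_ sIi] := sI i; have [_ sIj] := sI j.
have [w wS e1] := overlap i j _ ij (sIi _ _ Hxy _ zI) (sIj _ _ Hxy' _ zI').
by have := hphi _ _ w Hxy; rewrite -e1 zI.
Qed.

End FanModel.

(** * Excluded fans and complete bipartite graphs *)

Section Obstructions.
Variables (V : finType) (G : graph V).

Lemma disjoint_seq_nth (Xs : seq {set V}) i j : disjoint_seq Xs ->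
  i < size Xs -> j < size Xs -> i != j -> [disjoint nth set0 Xs i & nth set0 Xs j].
Proof.
move=> /(pairwiseP set0) dX ix jx; rewrite neq_ltn => /orP[ij|ij]; first exact: dX.
by rewrite disjoint_sym; apply: dX.
Qed.

Lemma fan_minor (S : {set 'I_4}) k (f : 'I_4 -> V) (Ys : seq {set V}) :
  0 < k -> k <= size Ys -> disjoint_seq Ys ->
  (forall Y, Y \in Ys -> exists phi I, [/\ model diamond G phi I,
     supported diamond phi I (f @: S :|: Y) & forall w, w \in S -> phi w = f w]) ->
  topological_minor (fan diamond S k) G.
Proof.
case: k => // k _ kY dY hY.
have szi (i : 'I_k.+1) : i < size Ys by apply: leq_trans (ltn_ord i) kY.
pose Y (i : 'I_k.+1) := nth set0 Ys i.
have /fin_all_exists[phi /fin_all_exists[I hI]] (i : 'I_k.+1) := hY (Y i) (mem_nth _ (szi i)).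
have [||||Phi [II mI]] := @fan_model _ diamond S k.+1 _ G ord0 phi I (fun i => f @: S :|: Y i).
- by move=> i; case: (hI i).
- by move=> i; case: (hI i).
- by move=> i j w wS; case: (hI i) => _ _ ->//; case: (hI j) => _ _ ->.
- move=> i j x ij xi xj.
  have: x \in f @: S.
    move: xi xj; rewrite !inE => /orP[->//|xi] /orP[->//|xj].
    have := disjoint_seq_nth dY (szi i) (szi j) ij.
    by move/disjointFr/(_ xi); rewrite -/(Y j) xj.
  by case/imsetP=> w wS ->; exists w => //; case: (hI i) => _ _ ->.
have [x _] := fan_lift S (ord0 : 'I_k.+1) d0.
exact: model_minor mI x.
Qed.

(** By [theta_model] every set is of one of three kinds, and enough sets of one kind give a fan with
    [S] empty, [S = {0}] or [S = {1}]. *)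
Lemma fan_few_thetas k0 k1 k2 : 0 < k0 -> 0 < k1 -> 0 < k2 ->
  ~ topological_minor (fan diamond set0 k0) G ->
  ~ topological_minor (fan diamond [set d0] k1) G ->
  ~ topological_minor (fan diamond [set d1] k2) G ->
  few_thetas G (k0 + k1 + k2).
Proof.
move=> k0p k1p k2p n0 n1 n2 v Xs dXs hXs.
have [b0 b0P] := finset_decide (fun X => exists phi I, model diamond G phi I /\ supported diamond phi I X).
have [b1 b1P] := finset_decide (fun X => exists phi I,
  [/\ model diamond G phi I, supported diamond phi I (v |: X) & phi d0 = v]).
have [b2 b2P] := finset_decide (fun X => exists phi I,
  [/\ model diamond G phi I, supported diamond phi I (v |: X) & phi d1 = v]).
have cover : size Xs <= count b0 Xs + count b1 Xs + count b2 Xs.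
  rewrite -(count_predT Xs); apply: leq_trans (_ : count (predU (predU b0 b1) b2) Xs <= _).
    rewrite (eq_in_count (a2 := predU (predU b0 b1) b2)) // => X /hXs/theta_model h.
    by apply/esym; rewrite /=; case: h => [/b0P->|/b1P->|/b2P->] //; rewrite ?orbT.
  by have := count_predUI (predU b0 b1) b2 Xs; have := count_predUI b0 b1 Xs; clear; lia.
have c0 : count b0 Xs < k0.
  rewrite ltnNge; apply/negP; rewrite -size_filter => kc; apply: n0.
  apply: (@fan_minor set0 k0 (fun=> v) _ k0p kc (pairwise_filter _ dXs)) => X.
  rewrite mem_filter => /andP[/b0P[phi [I [mI sI]]] _].
  by exists phi, I; split=> // [|w]; rewrite ?imset0 ?set0U // inE.
have one (b : pred {set V}) d k : (forall X, b X <-> exists phi I,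
    [/\ model diamond G phi I, supported diamond phi I (v |: X) & phi d = v]) ->
    0 < k -> ~ topological_minor (fan diamond [set d] k) G -> count b Xs < k.
  move=> bP kp nk; rewrite ltnNge; apply/negP; rewrite -size_filter => kc; apply: nk.
  apply: (@fan_minor [set d] k (fun=> v) _ kp kc (pairwise_filter _ dXs)) => X.
  rewrite mem_filter => /andP[/bP[phi [I [mI sI pd]]] _].
  by exists phi, I; split=> // [|w]; rewrite ?imset_set1 // inE => /eqP->.
have c1 := one _ _ _ b1P k1p n1; have c2 := one _ _ _ b2P k2p n2.
by move: cover c0 c1 c2; clear; lia.
Qed.

(** A path in [Q j] from a neighbour [u j] of [x] to a neighbour of [y] gives the branch vertex
    [u j], joined to [x] by an edge and to [y] along the rest of the path. *)
Lemma bipartite_few_links n :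
  ~ topological_minor (complete_bipartite 2 n) G -> few_links G n.
Proof.
move=> nK x y Qs xy dQs hQs; rewrite ltnNge; apply/negP=> nQ; apply: nK.
have szi (i : 'I_n) : i < size Qs by apply: leq_trans (ltn_ord i) nQ.
pose Q (i : 'I_n) := nth set0 Qs i.
have ex (i : 'I_n) : exists u p, [/\ [/\ G x u, path G u p & G y (last u p)],
    uniq (u :: p) & {subset u :: p <= Q i}].
  have [_ _ cQ [u uQ Gxu] [w wQ Gyw]] := hQs _ (mem_nth set0 (szi i)).
  have [p [pth we up ps]] := connect_path uQ (cQ _ _ uQ wQ).
  by exists u, p; rewrite -we.
have /fin_all_exists[u /fin_all_exists[p hp]] := ex.
have notQ (i : 'I_n) : x \notin Q i /\ y \notin Q i.
  by have [] := hQs _ (mem_nth set0 (szi i)).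
have uQ i : u i \in Q i by have [_ _ sub] := hp i; apply: sub; rewrite inE eqxx.
have pQ i : {subset p i <= Q i}.
  by have [_ _ sub] := hp i => z zp; apply: sub; rewrite inE zp orbT.
have Qdis i j z : z \in Q i -> z \in Q j -> i = j.
  move=> zi zj; apply/eqP; apply: contraT => ij.
  by have := disjoint_seq_nth dQs (szi i) (szi j) ij; move/disjointFr/(_ zi); rewrite -/(Q j) zj.
pose phi (t : 'I_2 + 'I_n) := match t with inl i => if val i == 0 then x else y | inr j => u j end.
pose J (s t : 'I_2 + 'I_n) := match s, t with
  | inl i, inr j => if val i == 0 then [::] else rev (p j)
  | _, _ => [::] end.
(* The side of two vertices comes first, so all edges are oriented towards the [u j]. *)
pose rk (t : 'I_2 + 'I_n) : nat := match t with inl i => val i | inr j => 2 + val j end.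
have rkI : injective rk.
  move=> [i|j] [i'|j'] /= e; first by congr inl; apply: val_inj.
  - by have := ltn_ord i; rewrite e; lia.
  - by have := ltn_ord i'; rewrite -e; lia.
  - by congr inr; apply: val_inj => /=; lia.
have phiI : injective phi.
  have xyu j z : z \in [:: x; y] -> z = u j -> False.
    by have [xQ yQ] := notQ j; rewrite !inE => /orP[] /eqP-> e; move: (uQ j); rewrite -e ?(negPf xQ) ?(negPf yQ).
  move=> [[[|[|i]] hi]|j] [[[|[|i']] hi']|j'] //= e.
  - by congr inl; apply: val_inj.
  - by rewrite e eqxx in xy.
  - by case: (xyu j' x) => //; rewrite inE eqxx.
  - by rewrite e eqxx in xy.
  - by congr inl; apply: val_inj.
  - by case: (xyu j' y) => //; rewrite !inE eqxx orbT.
  - by case: (xyu j x) => //; rewrite inE eqxx.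
  - by case: (xyu j y) => //; rewrite !inE eqxx orbT.
  - by congr inr; apply: (Qdis _ _ (u j)); rewrite // e.
apply: (model_minor (model_oriented rkI phiI (J := J) _ _) (inl ord0)).
  move=> [[[|[|i]] hi]|j] [i'|j'] //= _ lt.
  - have [[Gxu _ _] _ _] := hp j'; split=> //; rewrite /J /model_path /= ?Gxu // inE.
    by rewrite andbT; apply: contraTneq (uQ j') => <-; case: (notQ j').
  - have [[_ pth Gyl] un sub] := hp j'.
    have e : rcons (rev (p j')) (u j') = rev (u j' :: p j') by rewrite rev_cons.
    rewrite /J /model_path /= e; split.
    + rewrite lastI rev_rcons /= Gyl.
      have := rev_path G (u j') (p j') => ->.
      by rewrite (eq_path (e' := G)) // => s t; rewrite adj_sym.
    + rewrite rev_uniq un mem_rev andbT; apply/negP=> /sub; apply/negP.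
      by case: (notQ j').
    + move=> w; rewrite mem_rev; apply/negP=> wp.
      have wQ := pQ _ _ wp; have [xQ yQ] := notQ j'.
      case: w wp wQ => [i|j] /= wp wQ; first by move: wQ; case: ifP; rewrite ?(negPf xQ) ?(negPf yQ).
      have e' : j = j' := Qdis _ _ _ (uQ j) wQ.
      by move: un wp; rewrite /= -e' => /andP[/negPf->].
  - by move: lt; have := ltn_ord i'; clear; lia.
move=> [i|j] [i'|j'] [l|m] [l'|m'] //= _ lt _ lt' ne z; rewrite /J.
- case: ifP => // i0; case: ifP => // l0; rewrite !mem_rev => /pQ z1 /pQ z2.
  case/eqP: ne; have e := Qdis _ _ _ z1 z2; congr (inl _, inr _) => //.
  have one (t : 'I_2) : (val t == 0) = false -> val t = 1 by case: t => [[|[|t]] ht].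
  by apply: val_inj; rewrite (one _ i0) (one _ l0).
Qed.

End Obstructions.

(** * Bounds between the parameters *)

(** Parameters are relations, so boundedness includes the existence of the value; classical descent
    finds the minimum. *)
Lemma exists_min (P : nat -> Prop) M :
  (exists n, P n /\ n <= M) -> exists l, is_min P l /\ l <= M.
Proof.
case=> n; elim/ltn_ind: n => n IH [Pn nM].
have [[m [mn Pm]]|no] := classic (exists m, m < n /\ P m).
  by apply: (IH m mn); split=> //; apply: leq_trans (ltnW mn) nM.
exists n; split=> //; split=> // k Pk; rewrite leqNgt; apply/negP=> kn; apply: no; by exists k.
Qed.

Lemma exists_max (P : nat -> Prop) M : P 0 ->
  (forall n, P n -> n <= M) -> exists l, is_max P l /\ l <= M.
Proof.
elim: M => [|M IH] P0 PM; first by exists 0; split.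
have [PM1|nPM1] := classic (P M.+1); first by exists M.+1; split.
have [|l [Pl lM]] := IH P0; last by exists l; split=> //; apply: leqW.
move=> n Pn; have := PM n Pn; rewrite leq_eqVlt => /predU1P[e|//].
by rewrite e in Pn.
Qed.

Lemma set2_inj (T : finType) (x y a b : T) :
  [set x; y] = [set a; b] -> x = a /\ y = b \/ x = b /\ y = a.
Proof.
move=> e.
have /set2P xab : x \in [set a; b] by rewrite -e set21.
have /set2P yab : y \in [set a; b] by rewrite -e set22.
have /set2P axy : a \in [set x; y] by rewrite e set21.
have /set2P bxy : b \in [set x; y] by rewrite e set22.
by case: xab; case: yab; case: axy; case: bxy => *; intuition congruence.
Qed.

Lemma edgesP (V : finType) (G : graph V) (e : {set V}) : reflect (exists x y, G x y /\ e = [set x; y]) (e \in edges G).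
Proof.
apply: (iffP imset2P) => [[x y _ + ->]|[x [y [Gxy ->]]]]; last by exists x y; rewrite ?inE.
by rewrite inE => /andP[_ Gxy]; exists x, y.
Qed.

Lemma mem_edges (V : finType) (G : graph V) x y : ([set x; y] \in edges G) = G x y.
Proof.
apply/edgesP/idP => [[a [b [Gab /set2_inj]]]|Gxy]; last by exists x, y.
by case=> -[-> ->] //; rewrite adj_sym.
Qed.

Lemma theta_subgraph (V : finType) (G G' : graph V) X :
  (forall x y, G x y -> G' x y) -> theta G X -> theta G' X.
Proof.
move=> sub [a [b [p1 [p2 [p3 [[h1 h2 h3 un] n1 n2 s]]]]]].
by exists a, b, p1, p2, p3; split=> //; split=> //; apply: sub_path sub _ _ _.
Qed.

(** * Comparing capacity, edit distance and edge-brittleness *)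

Section EditDistance.
Variables (V : finType) (G : graph V).

(** Sets that share only pairwise nonadjacent vertices induce edge-disjoint subgraphs. *)
Lemma capacity_many n (U : 'I_n -> {set V}) : (forall i, theta G (U i)) ->
  (forall i j x y, i != j -> x \in U i -> x \in U j -> y \in U i -> y \in U j -> ~~ G x y) ->
  exists H : 'I_n -> subgraph G, (forall i, ~ diamond_free (sub_graph (H i))) /\
    (forall i j, i != j -> [disjoint sub_edges (H i) & sub_edges (H j)]).
Proof.
move=> thU disU.
pose H i : subgraph G := @Subgraph _ G (U i) (induced G (U i)) (fun x y h => h).
exists H; split=> [i|i j ij]; first by move=> nf; apply: nf; apply/theta_minor/thU.
have edge l e : e \in sub_edges (H l) -> exists x y, [/\ G x y, e = [set x; y], x \in U l & y \in U l].
  case/imsetP=> e' /edgesP[x [y [Gxy ->]]] ->; exists (val x), (val y).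
  by rewrite imsetU !imset_set1; split=> //; apply: valP.
rewrite disjoint_subset; apply/subsetP=> e /edge[x [y [Gxy e1 xi yi]]].
rewrite inE; apply/negP=> /edge[x' [y' [_ e2 xj yj]]].
suff [xj' yj'] : x \in U j /\ y \in U j by have := disU i j x y ij xi xj' yi yj'; rewrite Gxy.
by move: e2; rewrite e1 => /set2_inj[] [-> ->].
Qed.

(** Each [H i] has an edge outside [G'], or else its diamond would be one of [G']; edge-disjointness
    makes these edges distinct. *)
Lemma capacity_le_edit (G' : graph V) l (H : 'I_l -> subgraph G) :
  diamond_free G' -> (forall i, ~ diamond_free (sub_graph (H i))) ->
  (forall i j, i != j -> [disjoint sub_edges (H i) & sub_edges (H j)]) ->
  l <= #|edges G :\: edges G'|.
Proof.
move=> free nfree dis.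
have /fin_all_exists[f hf] i : exists e, e \in sub_edges (H i) /\ e \in edges G :\: edges G'.
  apply: NNPP => no; apply: (nfree i) => /minor_model[phi [I mI]]; apply: free.
  apply: (model_minor _ d0); apply: (model_map (g := val)) mI (supportedT _ _ _) _ _.
    by move=> x y _ _; apply: val_inj.
  move=> x y _ _ Hxy; apply: contraT => nG'; case: no.
  exists [set val x; val y]; split.
    by apply/imsetP; exists [set x; y]; rewrite ?mem_edges // imsetU !imset_set1.
  by rewrite inE !mem_edges nG' (sub_adj Hxy).
have finj : injective f.
  move=> i j e; apply/eqP; apply: contraT => ij.
  have [ei _] := hf i; have [ej _] := hf j.
  by rewrite e in ei; have := dis i j ij; move/disjointFr/(_ ei); rewrite ej.
rewrite -{1}(card_ord l) -(card_codom finj); apply: subset_leq_card.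
by apply/subsetP=> e /codomP[i ->]; case: (hf i).
Qed.

(** Without the cross edges every component lies inside a block, and a theta would lie in one
    component. *)
Lemma edit_le_brittleness (P : {set {set V}}) : partition P [set: V] ->
  (forall U, U \in P -> diamond_free (induced G U)) ->
  exists G' : graph V, diamond_free G' /\
    #|(edges G' :\: edges G) :|: (edges G :\: edges G')| <= #|cross_edges G P|.
Proof.
move=> pP free; pose e x y := G x y && (pblock P x == pblock P y).
have esym : symmetric e by move=> x y; rewrite /e adj_sym eq_sym.
have eirr : irreflexive e by move=> x; rewrite /e adj_irr.
exists (Graph esym eirr); split.
  apply/diamond_freeE => /theta_component[Q /componentsP[x _ ->]] th.
  have xP : pblock P x \in P.
    by apply: pblock_mem; case/and3P: pP => /eqP-> _ _; rewrite inE.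
  apply: (free _ xP); apply/theta_minor.
  apply: theta_mono (theta_subgraph (G' := G) _ th); last by move=> y z /andP[].
  have step y z : connect (within (Graph esym eirr) [set: V]) y z -> pblock P y = pblock P z.
    case/connectP=> p pth ->; elim: p y pth => //= t p IH y /andP[/and3P[_ _ /andP[_ /eqP->]]].
    exact: IH.
  apply/subsetP=> y; rewrite inE => /andP[_ /step->].
  by rewrite mem_pblock; case/and3P: pP => /eqP-> _ _; rewrite inE.
apply: subset_leq_card; apply/subsetP=> d; rewrite inE => /orP[] /setDP[] /edgesP[x [y [Gxy ->]]].
  by rewrite mem_edges; case/andP: Gxy => ->.
rewrite mem_edges /= /e Gxy /= => ne.
by apply/imset2P; exists x y; rewrite ?inE // Gxy.
Qed.

(** The colour classes given by [colouring] serve as blocks. *)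
Lemma brittleness_bound N K : 0 < N -> few_thetas G N -> few_links G K ->
  exists l, edge_brittleness diamond_free G l /\ l <= N * edit_loss N K.
Proof.
move=> N0 fT fL.
have [|col [free bi]] := @colouring _ _ N K N0 fT fL N [set: V].
  move=> Xs dXs hXs; case: Xs dXs hXs => // X Xs dXs hXs.
  have [[a _] _] := hXs X (mem_head _ _).
  by apply: (fT a) => // Y /hXs[tY _]; apply: theta_mono tY; apply: subsetUr.
apply: exists_min; exists #|cross_edges G (preim_partition col [set: V])|; split.
  exists (preim_partition col [set: V]); split=> //; first exact: preim_partitionP.
  move=> U /imsetP[x _ Ue] /theta_minor th.
  apply: (free (col x)); apply: theta_mono th; rewrite Ue; apply/subsetP=> y.
  by rewrite !inE eq_sym.
apply: leq_trans bi; rewrite /bichromatic pair_big /=.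
have pb x y : (pblock (preim_partition col [set: V]) x == pblock (preim_partition col [set: V]) y)
    = (col x == col y).
  have pP := preim_partitionP col [set: V].
  case/and3P: (pP) => /eqP cov tI _.
  rewrite eq_pblock // ?cov ?inE //.
  by rewrite pblock_equivalence_partition ?inE // => a b c _ _ _; split=> // /eqP->.
apply: (@leq_trans #|[set e : V * V | G e.1 e.2 && (col e.1 != col e.2)]|).
  apply: leq_trans (leq_imset_card (fun e : V * V => [set e.1; e.2]) _).
  apply: subset_leq_card; apply/subsetP=> e /imset2P[x y _].
  rewrite inE pb => /andP[_ h] ->; apply/imsetP; exists (x, y) => //.
  by rewrite inE.
rewrite -sum1_card big_mkcond [leqRHS]big_mkcond /=.
by apply: leq_sum => -[x y] _; rewrite !inE /=; case: (G x y && _).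
Qed.

End EditDistance.

(** * Edge-disjoint thetas in fans and in [K_{2,3n}] *)

Lemma fan_in_copy (W : finType) (H : graph W) (S : {set W}) k (i : 'I_k) (x y : fan_vertex S k) :
  in_copy i x -> in_copy i y -> fan H S k x y = H (fan_proj x) (fan_proj y).
Proof. by case: x => [u|[j u]]; case: y => [v|[l v]] //= /eqP-> /eqP->; rewrite eqxx. Qed.

(** Two copies share only [S], and a set of at most one vertex spans no edge. *)
Lemma fan_thetas (S : {set 'I_4}) n : #|S| <= 1 ->
  exists U : 'I_n -> {set fan_vertex S n}, (forall i, theta (fan diamond S n) (U i)) /\
    forall i j x y, i != j -> x \in U i -> x \in U j -> y \in U i -> y \in U j ->
      ~~ fan diamond S n x y.
Proof.
move=> S1; exists (fun i => [set x | in_copy i x]); split=> [i|i j x y ij].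
  have /fin_all_exists[g hg] := @fan_lift _ S n i.
  have gi w : in_copy i (g w) by case: (hg w).
  have gK w : fan_proj (g w) = w by case: (hg w).
  apply: (model_theta (model_map (g := g) (model_refl diamond) (supportedT _ _ _) _ _)).
  - by move=> u v _ _ e; rewrite -(gK u) e gK.
  - by move=> u v _ _ uv; rewrite (fan_in_copy _ (gi u) (gi v)) !gK.
  - by apply: supported_map (supportedT _ _ _) _ => w _; rewrite inE.
rewrite !inE => xi xj yi yj; rewrite (fan_in_copy _ xi yi).
have xS := in_copy2 ij xi xj; have yS := in_copy2 ij yi yj.
have [s Ss] : exists s, S \subset [set s].
  have [S0|[s sS]] := set_0Vmem S; first by exists d0; rewrite S0 sub0set.
  by exists s; apply/subsetP=> t tS; rewrite inE; apply/eqP; apply: (card_le1_eqP S1).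
by move: (subsetP Ss _ xS) (subsetP Ss _ yS); rewrite !inE => /eqP-> /eqP->; rewrite adj_irr.
Qed.

(** Blocks of three right-hand vertices, each with both left-hand ones as ends; the two shared
    vertices are not adjacent. *)
Lemma bipartite_thetas n :
  exists U : 'I_n -> {set ('I_2 + 'I_(3 * n))%type},
    (forall i, theta (complete_bipartite 2 (3 * n)) (U i)) /\
    forall i j x y, i != j -> x \in U i -> x \in U j -> y \in U i -> y \in U j ->
      ~~ complete_bipartite 2 (3 * n) x y.
Proof.
pose block (i : 'I_n) (x : ('I_2 + 'I_(3 * n))%type) :=
  match x with inl _ => true | inr j => val j %/ 3 == val i end.
exists (fun i => [set x | block i x]); split=> [i|i j x y ij].
  have lt t : t < 3 -> 3 * i + t < 3 * n by have := ltn_ord i; lia.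
  have quot t : t < 3 -> (3 * i + t) %/ 3 = i.
    by move=> t3; rewrite mulnC divnMDl // divn_small ?addn0.
  pose p t (h : t < 3) : seq ('I_2 + 'I_(3 * n))%type := [:: inr (Ordinal (lt t h))].
  exists (inl ord0), (inl ord_max), (p 0 isT), (p 1 isT), (p 2 isT); split=> //.
    split=> //; rewrite /= !inE /=.
    rewrite /eq_op /= /eq_op /= !addn0; lia.
  move=> x; rewrite !inE => /or4P[/eqP->|/eqP->|/eqP->|/orP[/eqP->|/eqP->]] //=;
    by rewrite /block /= quot.
rewrite !inE; case: x => [a|a]; case: y => [b|b] //=.
  by move=> _ _ /eqP bi /eqP bj; case/eqP: ij; apply: val_inj; rewrite /= -[LHS]bi -[RHS]bj.
by move=> /eqP bi /eqP bj; case/eqP: ij; apply: val_inj; rewrite /= -[LHS]bi -[RHS]bj.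
Qed.

Lemma bounded_capacity_excludes (GG : graph_class) (V : nat -> finType) (G : forall n, graph (V n)) :
  bounded_on (capacity diamond_free) GG ->
  (forall n, exists U : 'I_n -> {set V n}, (forall i, theta (G n) (U i)) /\
    forall i j x y, i != j -> x \in U i -> x \in U j -> y \in U i -> y \in U j -> ~~ G n x y) ->
  exists n, ~ GG _ (G n.+1).
Proof.
case=> M hM hU; exists M => /hM[l [[_ max] lM]].
have [U [thU disU]] := hU M.+1.
by have := max _ (capacity_many thU disU); rewrite ltnNge lM.
Qed.

(** * Equivalence of the four conditions *)

Theorem theorem1p4 (GG : graph_class) (GG_ideal : ideal GG) :
  [<-> bounded_on (capacity diamond_free) GG;
       bounded_on (edit_distance diamond_free) GG;
       bounded_on (edge_brittleness diamond_free) GG;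
       (forall S : {set 'I_4}, #|S| <= 1 -> ~ subclass (FAN diamond S) GG) /\
       ~ subclass K2_star GG].
Proof.
have [_ minor_closed] := GG_ideal.
have capacity_excl : bounded_on (capacity diamond_free) GG ->
    (forall S : {set 'I_4}, #|S| <= 1 -> ~ subclass (FAN diamond S) GG) /\ ~ subclass K2_star GG.
  move=> bnd; split=> [S S1 sub|sub].
    have [n] := bounded_capacity_excludes bnd (fun n => fan_thetas n S1).
    apply; apply: sub; exists n.+1; split=> //.
    by have [x _] := fan_lift S (ord0 : 'I_n.+1) d0; apply: minor_refl.
  have [n] := bounded_capacity_excludes bnd bipartite_thetas.
  by apply; apply: sub; exists (3 * n.+1); apply: minor_refl; apply: (inl ord0).
have excl_brittle : (forall S : {set 'I_4}, #|S| <= 1 -> ~ subclass (FAN diamond S) GG) /\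
    ~ subclass K2_star GG -> bounded_on (edge_brittleness diamond_free) GG.
  case=> nfan nK.
  (* By closure under topological minors, [GG] would contain all of [FAN] if it contained every
     [fan]. *)
  have nfan' (S : {set 'I_4}) : #|S| <= 1 -> exists k, 0 < k /\ ~ GG _ (fan diamond S k).
    move=> S1; apply: NNPP => no; apply: (nfan S S1) => W H [k [k0 mH]].
    apply: minor_closed mH _; apply: NNPP => nG; apply: no; by exists k.
  (* The three sets match the cases of [theta_model]: a theta that avoids the vertex, or meets it in
     degree two, or in degree three. *)
  have [k0 [k0p n0]] : exists k, 0 < k /\ ~ GG _ (fan diamond set0 k).
    by apply: nfan'; rewrite cards0.
  have [k1 [k1p n1]] : exists k, 0 < k /\ ~ GG _ (fan diamond [set d0] k).
    by apply: nfan'; rewrite cards1.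
  have [k2 [k2p n2]] : exists k, 0 < k /\ ~ GG _ (fan diamond [set d1] k).
    by apply: nfan'; rewrite cards1.
  have [n nn] : exists n, ~ GG _ (complete_bipartite 2 n).
    apply: NNPP => no; apply: nK => W H [n mH].
    apply: minor_closed mH _; apply: NNPP => nG; apply: no; by exists n.
  exists ((k0 + k1 + k2) * edit_loss (k0 + k1 + k2) n) => V G GGG.
  apply: brittleness_bound; first by rewrite !addn_gt0 k0p.
    by apply: fan_few_thetas => // /minor_closed/(_ GGG).
  by apply: bipartite_few_links => /minor_closed/(_ GGG).
have brittle_edit : bounded_on (edge_brittleness diamond_free) GG ->
    bounded_on (edit_distance diamond_free) GG.
  case=> M hM; exists M => V G /hM[l [[[P [pP free Pl]] _] lM]].
  have [G' [fG' le]] := edit_le_brittleness pP free.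
  apply: exists_min; exists #|(edges G' :\: edges G) :|: (edges G :\: edges G')|; split.
    by exists G'.
  by apply: leq_trans le _; rewrite Pl.
have edit_capacity : bounded_on (edit_distance diamond_free) GG ->
    bounded_on (capacity diamond_free) GG.
  case=> M hM; exists M => V G /hM[l [[[G' [fG' Gl]] _] lM]].
  apply: exists_max.
    have H0 : 'I_0 -> subgraph G by case.
    by exists H0; split=> -[].
  move=> n [H [nfree dis]]; apply: leq_trans lM; rewrite -Gl.
  apply: leq_trans (capacity_le_edit fG' nfree dis) _.
  by apply: subset_leq_card; apply: subsetUr.
(* The implications form one cycle: capacity, exclusion, edge-brittleness, edit distance, capacity.
   All those asked for are composites along it. *)
tfae; auto.
Qed.
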